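(* Let $k\geqslant 2$ and $p>1$ be integers, let $\varepsilon>0$ be arbitrary, and let $q\geqslant 2$ be a (large) natural number such that $$\theta(q)=\frac{\ln\bigl(6(1+\ln q)\bigr)}{\ln q}<\frac{1}{k},$$ and such that $\gcd(q-1,p)=1$. Let $a\in\mathbb{Z}$ be arbitrary. Then there is a number $\lambda\in(0,1)$ depending only on $p$ and $q$ such that, as $x\to\infty$, $$\sum_{\substack{n\leqslant x\\ S(n)\equiv a \ (\mathrm{mod}\ p)}}\tau_k(n)=\frac{1}{p}\sum_{n\leqslant x}\tau_k(n)+O\!\left(x^{1-\frac{1}{k}+\theta(q)+\varepsilon}\right)+O\!\left(x^{\lambda+\varepsilon}\right).$$
   Context: For a natural number $n$ with base-$q$ expansion $n=c_0+c_1q+\dots+c_\nu q^\nu$, $0\leqslant c_i<q$, we write $S(n)=c_0+c_1+\dots+c_\nu$ for the sum of its base-$q$ digits. $\tau_k(n)$ denotes the number of solutions of $x_1x_2\cdots x_k=n$ in natural numbers $x_1,\dots,x_k$. The implied constants in the $O$-terms may depend on $k,p,q,\varepsilon$ but not on $x$. *)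

(* Defs.v *)
From HB Require Import structures.
From mathcomp Require Import all_boot all_order all_algebra.
From mathcomp Require Import all_classical all_reals all_analysis.

Set Implicit Arguments.
Unset Strict Implicit.
Unset Printing Implicit Defensive.

Import Order.TTheory GRing.Theory Num.Theory.

Local Open Scope ring_scope.

(* Base-q digit sum, for q >= 2: the i-th digit of n is (n %/ q ^ i) %% q, and
   it vanishes for i > n because then n < q ^ i. *)
Definition digit_sum (q n : nat) : nat :=
  (\sum_(i < n.+1) (n %/ q ^ i) %% q)%N.

(* Number of k-tuples of positive integers with product n; each factor of such
   a product is at most n, so ranging over 'I_n.+1 loses no solution. *)
Definition tau (k n : nat) : nat :=
  #|[set x : {ffun 'I_k -> 'I_n.+1} |
      [forall i, 0 < x i] && (\prod_i (x i : nat) == n)]|%N.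

Definition theta {R : realType} (q : nat) : R :=
  ln (6 * (1 + ln q%:R)) / ln q%:R.

(* For x >= 0, Num.truncn x is the integer part of x. *)
Definition sum_tau {R : realType} (k : nat) (x : R) : nat :=
  (\sum_(1 <= n < (Num.truncn x).+1) tau k n)%N.

Definition sum_tau_digit {R : realType} (k p q : nat) (a : int) (x : R) : nat :=
  (\sum_(1 <= n < (Num.truncn x).+1 |
      ((digit_sum q n)%:Z == a %[mod p%:Z])%Z) tau k n)%N.

(* Main.v *)
Require Import Defs.
From HB Require Import structures.
From mathcomp Require Import all_boot all_order all_algebra.
From mathcomp Require Import all_classical all_reals all_analysis.
From mathcomp Require Import complex zify ring lra.

Set Implicit Arguments.
Unset Strict Implicit.
Unset Printing Implicit Defensive.

Import Order.TTheory GRing.Theory Num.Theory Normc.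
Local Open Scope ring_scope.

(** Detecting the residue of S(n) by the characters e(b S(n) / p), 0 <= b < p, where
e(t) = exp(2 i pi t), leaves the sums of tau_k(n) e(b S(n) / p) over n <= x with
0 < b < p to be bounded.

In each factorisation of n into k factors, sum over the first largest factor m.  It
runs over an interval, and the product d of the other factors satisfies
d^k <= x^(k - 1), so one needs the sums of e(b S(n) / p) over the multiples n of the
moduli d <= x^(1 - 1/k).  Expanding the condition d | n in additive characters, writing
the fractions h / d in lowest terms a / r and cutting the range of n along base-q digits
reduces everything to the products over i < N of phi(q^i a / r + b / p), where
phi(s) = |1 + e(s) + ... + e((q - 1) s)|.

For q^i <= r < q^(i + 1) the first 2 i + 2 factors are treated on average: the fractions
a / r lie in distinct cells of length q^-(2 i + 2), and the sum over all cells of a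
majorant of the product factors digit by digit, each digit contributing at most
6 q (1 + ln q) = q^(1 + theta(q)).  The remaining factors are bounded uniformly: two
consecutive ones cannot both be close to q, because (q - 1) b / p is not an integer.
This saving depends only on p and q and gives the exponent lambda. *)

(** * Base-q digit sums *)

Lemma digit_sumE q K n : (1 < q)%N -> (n < q ^ K)%N ->
  digit_sum q n = (\sum_(i < K) (n %/ q ^ i) %% q)%N.
Proof.
move=> q_gt1; have q_gt0 := ltnW q_gt1.
have sum_widen a b : (n < q ^ a)%N -> (a <= b)%N ->
    (\sum_(i < a) (n %/ q ^ i) %% q = \sum_(i < b) (n %/ q ^ i) %% q)%N.
  move=> n_lt le_ab; rewrite -[RHS](big_mkord xpredT (fun i => (n %/ q ^ i) %% q)%N).
  rewrite (big_cat_nat (leq0n a) le_ab) /= big_mkord [X in (_ + X)%N]big_nat.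
  rewrite [X in (_ + X)%N]big1 ?addn0 // => i /andP[le_ai _].
  by rewrite divn_small ?mod0n // (leq_trans n_lt) // leq_pexp2l.
have n_lt : (n < q ^ n.+1)%N by rewrite (ltn_trans (ltnSn n)) // ltn_expl.
move=> n_ltK; rewrite /digit_sum.
have [le_nK|/ltnW le_Kn] := leqP n.+1 K; first exact: sum_widen.
by rewrite [RHS](sum_widen _ n.+1).
Qed.

Lemma digit_sum0 q : digit_sum q 0 = 0%N.
Proof. by rewrite /digit_sum big_ord1 div0n mod0n. Qed.

Lemma digit_sum_top q c M m : (1 < q)%N -> (c < q)%N -> (m < q ^ M)%N ->
  digit_sum q (c * q ^ M + m) = (c + digit_sum q m)%N.
Proof.
move=> q_gt1 lt_cq lt_mM; have q_gt0 : (0 < q)%N by exact: ltnW.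
have lt_cmM : (c * q ^ M + m < q ^ M.+1)%N.
  rewrite expnS; apply: (@leq_trans (c.+1 * q ^ M)); last by rewrite leq_mul2r lt_cq orbT.
  by rewrite mulSn addnC ltn_add2r.
rewrite (digit_sumE q_gt1 lt_cmM) (digit_sumE q_gt1 lt_mM) big_ord_recr /= addnC.
congr addn; first by rewrite divnMDl ?expn_gt0 ?q_gt0 // divn_small // addn0 modn_small.
apply: eq_bigr => i _.
have -> : (c * q ^ M = c * q ^ (M - i).-1 * q * q ^ i)%N.
  rewrite -!mulnA -expnS -expnD; congr (_ * _ ^ _)%N; have := ltn_ord i; lia.
by rewrite divnMDl ?expn_gt0 ?q_gt0 // modnMDl.
Qed.

(** * Divisor bound *)

Lemma size_divisorsM m n : (0 < m)%N -> (0 < n)%N ->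
  (size (divisors (m * n)) <= size (divisors m) * size (divisors n))%N.
Proof.
move=> m_gt0 n_gt0; rewrite -(size_allpairs pair (divisors m)).
pose split_divisor d := (gcdn d m, d %/ gcdn d m)%N.
have split_inj : injective split_divisor.
  move=> d e [gcd_eq quo_eq].
  by rewrite -(divnK (dvdn_gcdl d m)) -(divnK (dvdn_gcdl e m)) quo_eq gcd_eq.
rewrite -(size_map split_divisor); apply: uniq_leq_size.
  by rewrite map_inj_uniq ?divisors_uniq.
move=> y /mapP[d]; rewrite -dvdn_divisors ?muln_gt0 ?m_gt0 // => d_dvd ->.
apply/allpairsP; exists (split_divisor d) => /=; split=> //.
  by rewrite -dvdn_divisors // dvdn_gcdr.
have gcd_gt0 : (0 < gcdn d m)%N by rewrite gcdn_gt0 m_gt0 orbT.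
have coprime_quo : coprime (d %/ gcdn d m) (m %/ gcdn d m).
  by rewrite /coprime -(eqn_pmul2r gcd_gt0) muln_gcdl !divnK ?dvdn_gcdl ?dvdn_gcdr // mul1n.
rewrite -dvdn_divisors // -(Gauss_dvdr _ coprime_quo) -(dvdn_pmul2r gcd_gt0).
by rewrite divnK ?dvdn_gcdl // mulnAC divnK ?dvdn_gcdr.
Qed.

Lemma size_divisors_pfactor p a : prime p -> (size (divisors (p ^ a)) <= a.+1)%N.
Proof.
move=> p_prime; rewrite -(size_iota 0 a.+1) -(size_map (expn p) (iota 0 a.+1)).
apply: uniq_leq_size (divisors_uniq _) _ => d.
rewrite -dvdn_divisors ?expn_gt0 ?prime_gt0 // => /(dvdn_pfactor _ _ p_prime)[i le_ia ->].
by apply/mapP; exists i => //; rewrite mem_iota.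
Qed.

Lemma prod_prime_powers n : (0 < n)%N ->
  (n = \prod_(0 <= p < n.+1 | prime p) p ^ logn p n)%N.
Proof.
move=> n_gt0; rewrite -[LHS](partnT n_gt0) /partn [LHS]big_mkcond [RHS]big_mkcond /=.
by apply: eq_bigr => p _; case: ifP => // p_nprime; rewrite lognE p_nprime.
Qed.

Lemma size_divisors_le_prod n : (0 < n)%N ->
  (size (divisors n) <= \prod_(0 <= p < n.+1 | prime p) (logn p n).+1)%N.
Proof.
move=> n_gt0; rewrite {1}(prod_prime_powers n_gt0).
pose bounded m c := (0 < m)%N /\ (size (divisors m) <= c)%N.
suff [] : bounded (\prod_(0 <= p < n.+1 | prime p) p ^ logn p n)%N
  (\prod_(0 <= p < n.+1 | prime p) (logn p n).+1)%N by [].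
apply: (big_ind2 bounded) => // [m c m' c' [m_gt0 le_mc] [m'_gt0 le_mc']|p p_prime].
  split; first by rewrite muln_gt0 m_gt0.
  exact: leq_trans (size_divisorsM m_gt0 m'_gt0) (leq_mul le_mc le_mc').
split; [by rewrite expn_gt0 prime_gt0 | exact: size_divisors_pfactor].
Qed.

Lemma leq_wexp2r m n e : (m <= n)%N -> (m ^ e <= n ^ e)%N.
Proof. by case: e => // e; rewrite leq_exp2r. Qed.

Lemma leq_expS_exp2 j : exists2 c, (0 < c)%N & forall a, (a.+1 ^ j <= c * 2 ^ a)%N.
Proof.
case: j => [|j]; first by exists 1%N => // a; rewrite mul1n expn_gt0.
exists (j.+1 ^ j.+1 * 2 ^ j.+1)%N => [|a]; first by rewrite muln_gt0 !expn_gt0.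
have le_aS : (a.+1 <= j.+1 * 2 ^ (a %/ j.+1).+1)%N.
  apply: (@leq_trans (j.+1 * (a %/ j.+1).+1)); first by rewrite mulnC ltn_ceil.
  by rewrite leq_mul2l /= ltnW // ltn_expl.
apply: leq_trans (leq_wexp2r j.+1 le_aS) _.
by rewrite expnMn -mulnA leq_mul2l -expnM -expnD leq_exp2l // mulSn leq_add2l leq_divM orbT.
Qed.

Lemma leq_expS_pexp p j a : (2 ^ j <= p)%N -> (a.+1 ^ j <= p ^ a)%N.
Proof.
move=> le_jp; apply: leq_trans (leq_wexp2r j (ltn_expl a (ltnSn 1))) _.
by rewrite -expnM mulnC expnM leq_wexp2r.
Qed.

Lemma prod_if_ltn_le c a b : (0 < c)%N ->
  (\prod_(0 <= p < b) (if p < a then c else 1) <= c ^ a)%N.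
Proof.
move=> c_gt0; have [le_ab|/ltnW le_ba] := leqP a b.
  rewrite -big_mkcond -(big_nat_widen 0 a b xpredT) //.
  by rewrite prod_nat_const_nat subn0.
apply: (@leq_trans (\prod_(0 <= p < b) c)); first by apply: leq_prod => p _; case: ifP.
by rewrite prod_nat_const_nat subn0 leq_pexp2l.
Qed.

(* A prime p >= 2^j satisfies (a + 1)^j <= p^a, so only the primes below 2^j
   contribute to the constant. *)
Lemma divisor_bound j : exists c, forall n, (0 < n)%N ->
  (size (divisors n) ^ j <= c * n)%N.
Proof.
have [c c_gt0 expS_le] := leq_expS_exp2 j.
exists (c ^ (2 ^ j))%N => n n_gt0; pose small p := if (p < 2 ^ j)%N then c else 1%N.
apply: leq_trans (leq_wexp2r j (size_divisors_le_prod n_gt0)) _.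
rewrite (big_morph (expn^~ j) (fun a b => expnMn a b j) (exp1n j)).
apply: (@leq_trans (\prod_(0 <= p < n.+1 | prime p) (small p * p ^ logn p n))%N).
  apply: leq_prod => p p_prime; rewrite /small; case: ltnP => [_|le_jp].
    by apply: leq_trans (expS_le _) _; rewrite leq_mul2l leq_wexp2r ?orbT // prime_gt1.
  by rewrite mul1n leq_expS_pexp.
rewrite big_split /= -(prod_prime_powers n_gt0) leq_mul2r; apply/orP; right.
apply: leq_trans (prod_if_ltn_le _ n.+1 c_gt0).
by rewrite big_mkcond leq_prod // => p _; rewrite /small; case: prime; case: ifP.
Qed.

(** * Divisor functions *)

Lemma dvdn_bigprod (I : finType) (F : I -> nat) i : (F i %| \prod_j F j)%N.
Proof. by rewrite (bigD1 i) //= dvdn_mulr. Qed.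

Lemma tau_le_divisors k n : (0 < n)%N -> (tau k n <= size (divisors n) ^ k)%N.
Proof.
move=> n_gt0; pose divides : {pred 'I_n.+1} := [pred d : 'I_n.+1 | d %| n]%N.
apply: (@leq_trans #|ffun_on divides : {pred {ffun 'I_k -> 'I_n.+1}}|).
  apply: subset_leq_card; apply/fintype.subsetP => x; rewrite inE => /andP[_ /eqP prod_x].
  by apply/ffun_onP => i; rewrite inE -[X in (_ %| X)%N]prod_x (dvdn_bigprod (fun i => x i : nat)).
rewrite card_ffun_on card_ord leq_wexp2r // cardE -(size_map val).
apply: uniq_leq_size; first by rewrite (map_inj_uniq val_inj) enum_uniq.
by move=> _ /mapP[d d_dvd ->]; rewrite mem_enum inE in d_dvd; rewrite -dvdn_divisors.
Qed.

Lemma tau_widen k n X : (0 < n)%N -> (n <= X)%N ->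
  tau k n = #|[set x : {ffun 'I_k -> 'I_X.+1} | (\prod_i (x i : nat) == n)%N]|.
Proof.
move=> n_gt0 le_nX; have lt_nX : (n.+1 <= X.+1)%N by [].
pose widen (x : {ffun 'I_k -> 'I_n.+1}) := [ffun i => widen_ord lt_nX (x i)].
have prod_widen x : (\prod_i (widen x i : nat) = \prod_i (x i : nat))%N.
  by apply: eq_bigr => i _; rewrite ffunE.
have widen_inj : injective widen.
  move=> x y /ffunP eq_xy; apply/ffunP => i; apply: val_inj.
  by have := eq_xy i; rewrite !ffunE => -[].
rewrite /tau -(card_imset _ widen_inj); apply: eq_card => x; rewrite inE.
apply/imsetP/idP => [[y + ->]|/eqP prod_x].
  by rewrite inE prod_widen => /andP[].
have x_dvd i : (x i %| n)%N by rewrite -prod_x (dvdn_bigprod (fun i => x i : nat)).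
have x_le i : (x i < n.+1)%N by rewrite ltnS dvdn_leq.
have xE : x = widen [ffun i => inord (x i)].
  by apply/ffunP => i; apply: val_inj; rewrite !ffunE /= inordK.
exists [ffun i => inord (x i)] => //; rewrite inE -prod_widen -xE prod_x eqxx andbT.
by apply/forallP => i; rewrite ffunE inordK // (dvdn_gt0 n_gt0).
Qed.

Lemma sum_tau_ffun (V : nmodType) k X (h : nat -> V) :
  \sum_(1 <= n < X.+1) h n *+ tau k n =
  \sum_(x : {ffun 'I_k -> 'I_X.+1} | (0 < \prod_i (x i : nat) <= X)%N)
    h (\prod_i (x i : nat))%N.
Proof.
rewrite big_nat; under eq_bigr => n /andP[n_gt0 n_leX] do
  rewrite (tau_widen _ n_gt0 n_leX) -sumr_const.
rewrite (exchange_big_dep (fun x : {ffun 'I_k -> 'I_X.+1} =>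
  (0 < \prod_i (x i : nat) <= X)%N)) /=; last first.
  by move=> n x n_range; rewrite inE => /eqP ->.
apply: eq_bigr => x x_range.
under eq_bigl => n do rewrite inE eq_sym.
by rewrite big_nat1_cond_eq ltnS x_range.
Qed.

(** * Splitting off the first largest factor *)

(* The boolean j < i, read as 0 or 1, makes the inequality strict for j < i. *)
Definition first_max n (x : 'I_n -> nat) (i : 'I_n) : bool :=
  [forall j : 'I_n, ((j < i) + x j <= x i)%N].

Lemma sum_first_max (V : nmodType) n (x : 'I_n.+1 -> nat) (v : V) :
  \sum_(i | first_max x i) v = v.
Proof.
pose M := (\max_j x j)%N; have le_M j : (x j <= M)%N by exact: leq_bigmax.
have [i1 ME] : {i1 | M = x i1} by apply: bigop.eq_bigmax; rewrite card_ord.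
have [|i le_Mi min_i] := @arg_minnP _ i1 (fun i => M <= x i)%N val; first by rewrite ME.
rewrite (big_pred1 i) // => j; apply/idP/eqP => [/forallP max_j|->].
  have le_Mj : (M <= x j)%N by apply: leq_trans le_Mi (leq_trans (leq_addl _ _) (max_j i)).
  apply: val_inj; apply/eqP; rewrite eqn_leq (min_i _ le_Mj) andbT leqNgt.
  apply/negP => lt_ij; have := leq_trans (max_j i) (le_M j).
  by rewrite lt_ij add1n ltnNge le_Mi.
apply/forallP => l; have [lt_li|le_il] := ltnP l i; last by rewrite (leq_trans (le_M l)).
rewrite add1n (leq_trans _ le_Mi) // ltn_neqAle le_M andbT.
by apply: contraL lt_li => /eqP xlE; rewrite -leqNgt min_i // xlE.
Qed.

Section FfunInsert.
Variables (T : finType) (n : nat) (i : 'I_n.+1).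
Implicit Types (m : T) (y : {ffun 'I_n -> T}).

Definition ffun_insert m y : {ffun 'I_n.+1 -> T} :=
  [ffun j => if unlift i j is Some j' then y j' else m].

Lemma ffun_insert_id m y : ffun_insert m y i = m.
Proof. by rewrite ffunE unlift_none. Qed.

Lemma ffun_insert_lift m y j : ffun_insert m y (lift i j) = y j.
Proof. by rewrite ffunE liftK. Qed.

Lemma big_ffun_insert (R : Type) (idx : R) (op : Monoid.com_law idx)
    (P : pred {ffun 'I_n.+1 -> T}) (F : {ffun 'I_n.+1 -> T} -> R) :
  \big[op/idx]_(x | P x) F x =
  \big[op/idx]_y \big[op/idx]_(m | P (ffun_insert m y)) F (ffun_insert m y).
Proof.
rewrite pair_big_dep (reindex (fun z => ffun_insert z.2 z.1)) //=.
exists (fun x => ([ffun j => x (lift i j)], x i)) => [[y m]|x] _ /=.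
  by congr pair; [apply/ffunP => j; rewrite ffunE ffun_insert_lift | rewrite ffun_insert_id].
apply/ffunP => j; case: (unliftP i j) => [j' ->|->].
  by rewrite ffun_insert_lift ffunE.
by rewrite ffun_insert_id.
Qed.

End FfunInsert.

Lemma prod_ffun_insert X n (i : 'I_n.+1) (m : 'I_X) (y : {ffun 'I_n -> 'I_X}) :
  (\prod_j (ffun_insert i m y j : nat) = m * \prod_j (y j : nat))%N.
Proof.
rewrite (bigD1_ord i) //= ffun_insert_id; congr muln.
by apply: eq_bigr => j _; rewrite ffun_insert_lift.
Qed.

Lemma first_max_ffun_insert X n (i : 'I_n.+1) (m : 'I_X) (y : {ffun 'I_n -> 'I_X}) :
  first_max (fun j => ffun_insert i m y j) i = (\max_j ((lift i j < i) + y j) <= m)%N.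
Proof.
apply/forallP/bigmax_leqP => [max_i j _|le_m j].
  by have := max_i (lift i j); rewrite ffun_insert_lift ffun_insert_id.
rewrite ffun_insert_id; case: (unliftP i j) => [j' ->|->].
  by rewrite ffun_insert_lift le_m.
by rewrite ffun_insert_id ltnn.
Qed.

Lemma sum_over_largest_factor (V : nmodType) X d L (h : nat -> V) : (0 < d)%N ->
  \sum_(m < X.+1 | (0 < m * d <= X)%N && (L <= m)%N) h (m * d)%N =
  \sum_(maxn L 1 <= m < (X %/ d).+1) h (d * m)%N.
Proof.
move=> d_gt0; have lt_X : ((X %/ d).+1 <= X.+1)%N by rewrite ltnS leq_div.
rewrite big_geq_mkord (big_ord_widen_cond _ (fun m => maxn L 1 <= m)%N
  (fun m => h (d * m)%N) lt_X).
apply: eq_big => [m|m _]; last by rewrite mulnC.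
by rewrite geq_max muln_gt0 d_gt0 andbT ltnS leq_divRL // [LHS]andbC andbA.
Qed.

Section LargestFactor.
Variables (R : numDomainType) (V : normedZmodType R) (k X : nat).
Variables (h : nat -> V) (B : nat -> R).
Hypothesis norm_h_le : forall d L, (0 < d)%N -> (0 < L)%N -> (d * L <= X)%N ->
  `|\sum_(L <= m < (X %/ d).+1) h (d * m)%N| <= B d.

Lemma norm_sum_first_max_le (i : 'I_k.+1) :
  `|\sum_(x : {ffun 'I_k.+1 -> 'I_X.+1} |
      (0 < \prod_j (x j : nat) <= X)%N && first_max (fun j => x j) i)
      h (\prod_j (x j : nat))%N| <=
  \sum_(1 <= d < X.+1 | (d ^ k.+1 <= X ^ k)%N) B d *+ tau k d.
Proof.
pose C d := if (d ^ k.+1 <= X ^ k)%N then B d else 0.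
have -> : \sum_(1 <= d < X.+1 | (d ^ k.+1 <= X ^ k)%N) B d *+ tau k d =
    \sum_(1 <= d < X.+1) C d *+ tau k d.
  by rewrite big_mkcond; apply: eq_bigr => d _; rewrite /C; case: ifP; rewrite ?mul0rn.
rewrite sum_tau_ffun (big_ffun_insert i) [leRHS]big_mkcond.
apply: le_trans (ler_norm_sum _ _ _) _; apply: ler_sum => y _.
under eq_bigl => m do rewrite prod_ffun_insert first_max_ffun_insert.
under eq_bigr => m _ do rewrite prod_ffun_insert.
set d := (\prod_j (y j : nat))%N; set L := (\max_j ((lift i j < i) + y j))%N.
have [->|d_gt0] := posnP d; first by rewrite big_pred0 ?normr0 // => m; rewrite muln0.
rewrite sum_over_largest_factor //; set m0 := maxn L 1.
have [le_dm0|lt_X] := leqP (d * m0) X; last first.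
  rewrite big_geq ?normr0; last by rewrite ltn_divLR // mulnC.
  case: ifP => //= d_leX; rewrite /C; case: ifP => // _.
  by apply: le_trans (norm_h_le d_gt0 (ltn0Sn 0) _); rewrite ?muln1.
have m0_gt0 : (0 < m0)%N by rewrite leq_max orbT.
have d_le : (d <= m0 ^ k)%N.
  rewrite -[k in (_ ^ k)%N]card_ord -prod_nat_const; apply: leq_prod => j _.
  rewrite leq_max; apply/orP; left; apply: leq_trans (leq_bigmax j).
  exact: leq_addl.
have cond_d : (d ^ k.+1 <= X ^ k)%N.
  rewrite expnS; apply: (@leq_trans (m0 ^ k * d ^ k)); first by rewrite leq_mul2r d_le orbT.
  by rewrite -expnMn mulnC leq_wexp2r.
by rewrite (leq_trans (leq_pmulr _ m0_gt0) le_dm0) /C cond_d norm_h_le.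
Qed.

(* Each factorisation is charged to its first largest factor m.  The product d
   of the other k factors is at most m^k, so d^(k+1) <= (m d)^k <= X^k. *)
Lemma norm_sum_tau_le :
  `|\sum_(1 <= n < X.+1) h n *+ tau k.+1 n| <=
  k.+1%:R * \sum_(1 <= d < X.+1 | (d ^ k.+1 <= X ^ k)%N) B d *+ tau k d.
Proof.
rewrite sum_tau_ffun.
under eq_bigr => x _ do rewrite -(sum_first_max (fun j => x j) (h _)).
rewrite (exchange_big_dep xpredT) //=; apply: le_trans (ler_norm_sum _ _ _) _.
apply: le_trans (ler_sum _ (fun i _ => norm_sum_first_max_le i)) _.
by rewrite sumr_const card_ord mulr_natl.
Qed.

End LargestFactor.

(** * Sums over blocks and periods *)

Lemma big_ord_mul (R : Type) (idx : R) (op : Monoid.law idx) a b (F : nat -> R) :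
  \big[op/idx]_(n < a * b) F n =
  \big[op/idx]_(t < a) \big[op/idx]_(m < b) F (t * b + m)%N.
Proof.
rewrite -(big_mkord xpredT F) big_nat_mul big_mkord; apply: eq_bigr => t _.
rewrite -[X in index_iota X _]add0n big_addn mulSn addnK big_mkord.
by apply: eq_bigr => m _; rewrite addnC.
Qed.

Lemma sum_multiples (V : nmodType) d Z (F : nat -> V) : (0 < d)%N ->
  \sum_(n < Z * d | (d %| n)%N) F n = \sum_(m < Z) F (d * m)%N.
Proof.
move=> d_gt0; rewrite big_mkcond.
rewrite (big_ord_mul _ _ _ (fun n => if (d %| n)%N then F n else 0)).
apply: eq_bigr => m _; rewrite -big_mkcond (big_pred1 (Ordinal d_gt0)) /= => [|r].
  by rewrite addn0 mulnC.
rewrite /= dvdn_addr ?dvdn_mull //; apply/idP/eqP => [/dvdnP[[|c] rE]|->] //.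
  exact: val_inj.
by have := ltn_ord r; rewrite rE mulSn ltnNge leq_addr.
Qed.

Lemma sum_period_shift (V : nmodType) q (F : nat -> V) m :
  (forall n, F (n + q)%N = F n) -> \sum_(t < q) F (m + t)%N = \sum_(t < q) F t.
Proof.
move=> F_periodic; elim: m => [|m <-]; first by apply: eq_bigr.
case: q F_periodic => [|q] F_periodic; first by rewrite !big_ord0.
rewrite big_ord_recr big_ord_recl /= addrC addn0; congr (_ + _).
  by rewrite addSnnS F_periodic.
by apply: eq_bigr => t _; rewrite /bump /= add1n addSnnS.
Qed.

Lemma ler_sum_inj (R : numDomainType) (I J : finType) (A : {pred I}) (f : I -> J)
    (F : I -> R) (G : J -> R) :
  {in A &, injective f} -> (forall x, x \in A -> F x <= G (f x)) ->
  (forall y, 0 <= G y) -> \sum_(x in A) F x <= \sum_y G y.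
Proof.
move=> f_inj le_FG G_ge0; apply: le_trans (ler_sum _ le_FG) _.
rewrite -(big_imset G f_inj) /= [leRHS](bigID (mem (f @: A))) /= lerDl.
exact: sumr_ge0.
Qed.

Lemma harmonic_sum_le (R : realType) n : (0 < n)%N ->
  \sum_(1 <= u < n.+1) (u%:R^-1 : R) <= 1 + ln n%:R.
Proof.
elim: n => // -[|n] IHn _; first by rewrite big_nat1 invr1 ln1 addr0.
rewrite big_nat_recr //=; apply: le_trans (lerD (IHn isT) (lexx _)) _.
rewrite -addrA lerD2l -lerBrDl -[leRHS]opprB.
rewrite -ln_div ?posrE ?ltr0n // lerNr.
have -> : n.+1%:R / n.+2%:R = 1 + - n.+2%:R^-1 :> R.
  by rewrite -[n.+1%:R](addrK 1) natr1 mulrBl divff ?pnatr_eq0 // mul1r.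
by rewrite le_ln1Dx // ltrN2 invf_lt1 ?ltr0n // ltr1n.
Qed.

(** * The character t |-> exp (2 i pi t) *)

Section ComplexNorm.
Variable R : rcfType.
Implicit Types z : R[i].

Lemma normc_ge0 z : 0 <= normc z.
Proof. exact: (@normr_ge0 _ (Rcomplex R)). Qed.

Lemma normcX z n : normc (z ^+ n) = normc z ^+ n.
Proof. by elim: n => [|n IHn]; rewrite ?expr0 ?normc1 // !exprS normcM IHn. Qed.

Lemma normc_nat n : normc (n%:R : R[i]) = n%:R.
Proof. by rewrite -[n%:R]/(1 *+ n) (@normcMn R) normc1. Qed.

Lemma normc_real (r : R) : normc (r%:C)%C = `|r|.
Proof. by rewrite /= expr0n /= addr0 sqrtr_sqr. Qed.

Lemma normc_sum (I : Type) (r : seq I) (P : pred I) (F : I -> R[i]) :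
  normc (\sum_(i <- r | P i) F i) <= \sum_(i <- r | P i) normc (F i).
Proof. exact: (@ler_norm_sum _ (Rcomplex R)). Qed.

Lemma normc_sum_le (I : finType) (P : pred I) (F : I -> R[i]) b :
  (forall i, P i -> normc (F i) <= b) -> normc (\sum_(i | P i) F i) <= #|P|%:R * b.
Proof.
move=> F_le; apply: le_trans (normc_sum _ _ _) _.
by apply: le_trans (ler_sum _ F_le) _; rewrite sumr_const mulr_natl.
Qed.

End ComplexNorm.

Section CircleCharacter.
Import numFieldNormedType.Exports.
Variable R : realType.
Implicit Types s t : R.

Definition expi2pi t : R[i] := Complex (cos (2 * pi * t)) (sin (2 * pi * t)).

Lemma expi2piD s t : expi2pi (s + t) = expi2pi s * expi2pi t.
Proof.
by apply/eqP; rewrite eq_complex /= mulrDr cosD sinD eqxx (addrC (cos _ * sin _)) eqxx.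
Qed.

Lemma expi2pi0 : expi2pi 0 = 1.
Proof. by rewrite /expi2pi mulr0 cos0 sin0. Qed.

Lemma expi2pi1 : expi2pi 1 = 1.
Proof. by rewrite /expi2pi mulr1 mulr_natl cos2pi sin2pi. Qed.

Lemma expi2piMn n s : expi2pi (n%:R * s) = expi2pi s ^+ n.
Proof.
elim: n => [|n IHn]; first by rewrite mul0r expi2pi0 expr0.
by rewrite -natr1 mulrDl mul1r expi2piD IHn exprSr.
Qed.

Lemma expi2pi_nat n : expi2pi n%:R = 1.
Proof. by rewrite -[n%:R]mulr1 expi2piMn expi2pi1 expr1n. Qed.

Lemma expi2piDn s n : expi2pi (s + n%:R) = expi2pi s.
Proof. by rewrite expi2piD expi2pi_nat mulr1. Qed.

Lemma normc_expi2pi s : normc (expi2pi s) = 1.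
Proof. by rewrite /= cos2Dsin2 sqrtr1. Qed.

Lemma normc_expi2piX s n : normc (expi2pi s ^+ n) = 1.
Proof. by rewrite normcX normc_expi2pi expr1n. Qed.

Lemma normc_1Dexpi2pi_sqr s :
  normc (1 + expi2pi s) ^+ 2 + normc (1 - expi2pi s) ^+ 2 = 4.
Proof.
rewrite /= !sqr_sqrtr ?addr_ge0 ?sqr_ge0 //.
have := cos2Dsin2 (2 * pi * s); move: (cos _) (sin _) => c d cdE.
by rewrite (_ : 4 = 2 + 2 * (c ^+ 2 + d ^+ 2)); [ring | rewrite cdE; ring].
Qed.

Lemma normc_1Bexpi2pi s : normc (1 - expi2pi s) = 2 * `|sin (pi * s)|.
Proof.
have -> : expi2pi s = Complex (cos ((pi * s) *+ 2)) (sin ((pi * s) *+ 2)).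
  by rewrite /expi2pi -mulrA mulr_natl.
rewrite /= cos_mulr2n sin_mulr2n.
have := cos2Dsin2 (pi * s); move: (cos _) (sin _) => c d cdE.
have {}cdE : c ^+ 2 = 1 - d ^+ 2 by rewrite -cdE addrK.
rewrite -[2 in RHS]ger0_norm // -normrM -sqrtr_sqr; congr (Num.sqrt _).
rewrite cdE (_ : (0 - c * d *+ 2) ^+ 2 = 4 * c ^+ 2 * d ^+ 2); last by ring.
by rewrite cdE; ring.
Qed.

Lemma ler_cos : {in `[0, pi] &, {mono @cos R : x y /~ y <= x}}.
Proof. by move=> x y xI yI; rewrite !leNgt ltr_cos. Qed.

Lemma ler_sin : {in `[- (pi / 2), pi / 2] &, {mono @sin R : x y / x <= y}}.
Proof. by move=> x y xI yI; rewrite !leNgt ltr_sin. Qed.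

Lemma cos_sin_piquarter_ge : 2^-1 <= cos (pi / 4) :> R /\ 2^-1 <= sin (pi / 4) :> R.
Proof.
have pi_bound := @pi_ge2 R.
have cos_ge0 : 0 <= cos (pi / 4) :> R by apply: cos_ge0_pihalf; lra.
have sin_ge0 : 0 <= sin (pi / 4) :> R by apply: sin_ge0_pi; lra.
have := cos_mulr2n (pi / 4 : R); have := cos2Dsin2 (pi / 4 : R).
rewrite (_ : pi / 4 *+ 2 = pi / 2); last by rewrite -mulr_natr; field.
by rewrite cos_pihalf; split; nra.
Qed.

Lemma sin_pi_ge s : 0 <= s <= 2^-1 -> s <= sin (pi * s).
Proof.
move=> /andP[s_ge0 s_le2]; have pi_bound := @pi_ge2 R.
have [cos_ge sin_ge] := cos_sin_piquarter_ge.
have [le_s4|lt_4s] := leP s 4^-1; last first.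
  apply: (le_trans s_le2); apply: (le_trans sin_ge).
  by rewrite ler_sin ?in_itv /=; nra.
have [||c /[!in_itv] /= /andP[c_gt0 c_lt]] := @MVT_segment R sin cos 0 (pi * s).
- by rewrite mulr_ge0 // pi_ge0.
- exact/continuous_subspaceT/continuous_sin.
rewrite sin0 !subr0 => ->.
have cos_c_ge : 2^-1 <= cos c.
  by apply: (le_trans cos_ge); rewrite ler_cos ?in_itv /=; nra.
nra.
Qed.

Lemma normc_1Bexpi2pi_ge s : 0 <= s <= 1 ->
  2 * Num.min s (1 - s) <= normc (1 - expi2pi s).
Proof.
move=> /andP[s_ge0 s_le1]; rewrite normc_1Bexpi2pi ler_pM2l //.
apply: le_trans (ler_norm _).
have [le_s|lt_s] := leP s (1 - s); first by apply: sin_pi_ge; lra.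
have -> : sin (pi * s) = sin (pi * (1 - s)).
  by rewrite mulrBr mulr1 sinB sinpi cospi; ring.
by apply: sin_pi_ge; lra.
Qed.

Lemma normc_1Bexpi2pi_rat n d : ~~ (d %| n)%N ->
  2 / d%:R <= normc (1 - expi2pi (n%:R / d%:R)).
Proof.
move=> d_ndvd; have [->|d_gt0] := posnP d; first by rewrite invr0 mulr0 normc_ge0.
have dR_gt0 : 0 < d%:R :> R by rewrite ltr0n.
have -> : n%:R / d%:R = (n %% d)%:R / d%:R + (n %/ d)%:R :> R.
  by rewrite {1}(divn_eq n d) natrD natrM mulrDl mulfK ?gt_eqF // addrC.
rewrite expi2piDn; set s := (n %% d)%:R / _.
have s_ge : d%:R^-1 <= s.
  by rewrite -[leLHS]mul1r ler_pM2r ?invr_gt0 // ler1n lt0n.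
have s_le : d%:R^-1 <= 1 - s.
  rewrite lerBrDr -[X in X + _]mul1r -mulrDl ler_pdivrMr // mul1r nat1r.
  by rewrite ler_nat ltn_pmod.
have dV_gt0 : 0 < d%:R^-1 :> R by rewrite invr_gt0.
apply: le_trans (normc_1Bexpi2pi_ge _); last by lra.
by rewrite ler_pM2l // le_min s_ge s_le.
Qed.

Lemma sum_expi2pi_rat n d : (0 < d)%N ->
  \sum_(h < d) expi2pi (h%:R / d%:R) ^+ n = if (d %| n)%N then d%:R else 0.
Proof.
move=> d_gt0; have dR_neq0 : d%:R != 0 :> R by rewrite pnatr_eq0 -lt0n.
set z := expi2pi (n%:R / d%:R).
have -> : \sum_(h < d) expi2pi (h%:R / d%:R) ^+ n = \sum_(h < d) z ^+ h.
  by apply: eq_bigr => h _; rewrite /z -!expi2piMn; congr expi2pi; field.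
case: ifPn => [/dvdnP[m nE]|d_ndvd].
  rewrite (eq_bigr (fun=> 1)) ?sumr_const ?card_ord // => h _.
  by rewrite /z nE natrM mulfK // expi2pi_nat expr1n.
have z_root : z ^+ d = 1 by rewrite /z -expi2piMn mulrC divfK // expi2pi_nat.
have := subrX1 z d; rewrite z_root subrr => /esym/eqP.
rewrite mulf_eq0 subr_eq0 => /orP[/eqP z1|/eqP //].
have := normc_1Bexpi2pi_rat d_ndvd; rewrite -/z z1 subrr normc0.
by rewrite leNgt divr_gt0 // ltr0n.
Qed.

End CircleCharacter.

(** * The contribution of one digit *)

Lemma ler_pdivl_maxn1 (R : numFieldType) (F b : R) n : 0 <= F -> F <= b -> F * n%:R <= b ->
  F <= b / (maxn n 1)%:R.
Proof.
move=> F_ge0 le_Fb le_Fnb; rewrite ler_pdivlMr ?ltr0n ?leq_max ?orbT //.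
by rewrite /maxn; case: ifP => _; rewrite ?mulr1.
Qed.

Section DigitFactor.
Variables (R : realType) (q : nat).
Hypothesis q_gt0 : (0 < q)%N.
Implicit Types (s : R) (m : nat).

Definition digit_factor s : R := normc (\sum_(c < q) expi2pi s ^+ c).

Lemma digit_factor_ge0 s : 0 <= digit_factor s.
Proof. exact: normc_ge0. Qed.

Lemma digit_factorDn s n : digit_factor (s + n%:R) = digit_factor s.
Proof. by rewrite /digit_factor expi2piDn. Qed.

Lemma digit_factor_le s : digit_factor s <= q%:R.
Proof.
rewrite -[leRHS]mulr1 -[q in leRHS]card_ord; apply: normc_sum_le => c _.
by rewrite normc_expi2piX.
Qed.

Lemma digit_factor_mul s : digit_factor s * normc (1 - expi2pi s) <= 2.
Proof.
rewrite -normcM -[1 - expi2pi s]opprB mulrN normcN mulrC -subrX1.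
by apply: le_trans (le_normcD _ _) _; rewrite normcN normc_expi2piX normc1.
Qed.

Lemma digit_factor_min s : 0 <= s <= 1 -> digit_factor s * Num.min s (1 - s) <= 1.
Proof.
move=> s01; have := ler_wpM2l (digit_factor_ge0 s) (normc_1Bexpi2pi_ge s01).
by have := digit_factor_mul s; lra.
Qed.

Definition cell_weight m : R :=
  q%:R / (maxn (m %% q) 1)%:R + q%:R / (maxn (q.-1 - m %% q) 1)%:R.

Lemma cell_weight_ge0 m : 0 <= cell_weight m.
Proof. by rewrite addr_ge0 // divr_ge0. Qed.

Lemma cell_weightDq m : cell_weight (m + q) = cell_weight m.
Proof. by rewrite /cell_weight modnDr. Qed.

Lemma digit_factor_le_cell_weight m s :
  m%:R <= q%:R * s < m.+1%:R -> digit_factor s <= cell_weight m.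
Proof.
move=> /andP[m_le lt_m]; set u := (m %% q)%N; pose f := s - (m %/ q)%:R.
have qR_gt0 : 0 < q%:R :> R by rewrite ltr0n.
have mE : m%:R = (m %/ q)%:R * q%:R + u%:R :> R by rewrite -natrM -natrD -divn_eq.
have u_le : u%:R <= q%:R * f by rewrite /f; move: m_le; rewrite mE; lra.
have lt_u : q%:R * f < u%:R + 1 by rewrite /f; move: lt_m; rewrite -natr1 mE; lra.
have vE : (q.-1 - u)%:R + u%:R + 1 = q%:R :> R.
  by rewrite -natrD natr1 subnK ?prednK // -ltnS prednK // ltn_pmod.
have f_ge0 : 0 <= f by rewrite -(pmulr_rge0 _ qR_gt0) (le_trans _ u_le).
have f_le1 : f <= 1.
  by rewrite -(ler_pM2l qR_gt0) mulr1; have := ler0n R (q.-1 - u); lra.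
have -> : digit_factor s = digit_factor f.
  by rewrite -(digit_factorDn f (m %/ q)) /f subrK.
have F_ge0 := digit_factor_ge0 f; have F_le := digit_factor_le f.
have weight_ge0 n : 0 <= q%:R / (maxn n 1)%:R :> R by rewrite divr_ge0.
have F_mul n b : n%:R <= q%:R * b -> digit_factor f * b <= 1 ->
    digit_factor f <= q%:R / (maxn n 1)%:R.
  move=> le_n le_1; apply: ler_pdivl_maxn1 => //.
  by apply: le_trans (ler_wpM2l F_ge0 le_n) _; rewrite mulrCA ler_piMr // ltW.
have := @digit_factor_min f; rewrite f_ge0 f_le1 => /(_ isT).
have [_ /(F_mul _ _ u_le) F_le_u|_ F_min] := leP f (1 - f).
  by apply: le_trans F_le_u _; rewrite lerDl weight_ge0.
have v_le : (q.-1 - u)%:R <= q%:R * (1 - f) by lra.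
by apply: le_trans (F_mul _ _ v_le F_min) _; rewrite lerDr weight_ge0.
Qed.

Definition pair_weight m : R := cell_weight m + cell_weight m.+1.

Definition total_weight : R := \sum_(t < q) pair_weight t.

Lemma pair_weight_ge0 m : 0 <= pair_weight m.
Proof. by rewrite addr_ge0 // cell_weight_ge0. Qed.

Lemma total_weight_ge0 : 0 <= total_weight.
Proof. by apply: sumr_ge0 => t _; exact: pair_weight_ge0. Qed.

Lemma pair_weight_modDl t m : pair_weight (t * q + m) = pair_weight m.
Proof. by rewrite /pair_weight /cell_weight -addnS !modnMDl. Qed.

Lemma sum_pair_weight_shift m : \sum_(t < q) pair_weight (m + t) = total_weight.
Proof.
apply: sum_period_shift => n.
by rewrite -(pair_weight_modDl 1 n) mul1n addnC.
Qed.

Lemma digit_factor_le_pair_weight m s :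
  m%:R <= q%:R * s < m.+2%:R -> digit_factor s <= pair_weight m.
Proof.
move=> /andP[m_le lt_m]; have [le_m1|lt_m1] := leP m.+1%:R (q%:R * s).
  apply: (@le_trans _ _ (cell_weight m.+1)).
    by rewrite digit_factor_le_cell_weight ?le_m1.
  by rewrite lerDr cell_weight_ge0.
apply: (@le_trans _ _ (cell_weight m)).
  by rewrite digit_factor_le_cell_weight ?m_le.
by rewrite lerDl cell_weight_ge0.
Qed.

Lemma sum_cell_weight :
  \sum_(t < q) cell_weight t = 2 * q%:R * \sum_(t < q) (maxn t 1)%:R^-1.
Proof.
rewrite big_split /= [X in _ + X](reindex_inj rev_ord_inj) /=.
rewrite -mulrA mulr_natl mulr2n mulr_sumr; congr (_ + _); apply: eq_bigr => t _.
  by rewrite modn_small.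
have -> // : (q.-1 - (q - t.+1) %% q = t)%N.
by have := ltn_ord t => lt_tq; rewrite modn_small; lia.
Qed.

Lemma total_weight_le : total_weight <= 4 * q%:R * (2 + ln q%:R).
Proof.
have -> : total_weight = 2 * \sum_(t < q) cell_weight t.
  rewrite /total_weight big_split /= mulr_natl mulr2n; congr (_ + _).
  exact: (sum_period_shift 1 cell_weightDq).
rewrite sum_cell_weight !mulrA (_ : 2 * 2 = 4 :> R); last by ring.
rewrite ler_wpM2l ?mulr_ge0 // -(big_mkord xpredT (fun t => (maxn t 1)%:R^-1)).
rewrite big_ltn // max0n invr1 (_ : 2 = 1 + 1 :> R) // -addrA lerD2l.
apply: le_trans (harmonic_sum_le R q_gt0).
rewrite big_nat_recr //= (eq_big_nat _ _ (F2 := fun u => u%:R^-1)) => [|u /andP[u_gt0 _]].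
  by rewrite lerDl invr_ge0.
by rewrite (maxn_idPl u_gt0).
Qed.

End DigitFactor.

Arguments total_weight : clear implicits.
Arguments pair_weight : clear implicits.

Section DigitProduct.
Variables (R : realType) (q : nat) (beta : R).

Definition digit_product N alpha : R :=
  \prod_(i < N) digit_factor q (q%:R ^+ i * alpha + beta).

Lemma digit_product_ge0 N alpha : 0 <= digit_product N alpha.
Proof. by apply: prodr_ge0 => i _; exact: digit_factor_ge0. Qed.

Lemma digit_productD L N alpha :
  digit_product (L + N) alpha = digit_product L alpha * digit_product N (q%:R ^+ L * alpha).
Proof.
rewrite /digit_product big_split_ord /=; congr (_ * _); apply: eq_bigr => i _.
by rewrite exprD mulrA [_ ^+ i * _]mulrC.
Qed.

End DigitProduct.

Section Cells.
Variables (R : realType) (q : nat) (beta : R).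
Hypothesis q_gt0 : (0 < q)%N.
Hypothesis beta_ge0 : 0 <= beta.

Let qR_gt0 : 0 < q%:R :> R. Proof. by rewrite ltr0n. Qed.
Let qX_gt0 n : 0 < q%:R ^+ n :> R. Proof. exact: exprn_gt0. Qed.

(* For alpha in [j / q^L, (j + 1) / q^L[ the number q (q^i alpha + beta) lies in
   [m, m + 2[ with m = cell (L - i) j. *)
Definition cell l j : nat := Num.truncn (q%:R * (j%:R / q%:R ^+ l + beta)).

Definition cell_majorant N L j : R := \prod_(i < N) pair_weight R q (cell (L - i) j).

Lemma cell_majorant_ge0 N L j : 0 <= cell_majorant N L j.
Proof. by apply: prodr_ge0 => i _; exact: pair_weight_ge0. Qed.

Lemma cellD l v y j : (q * y = v * q ^ l)%N -> cell l (y + j) = (v + cell l j)%N.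
Proof.
move=> qyE; rewrite /cell natrD mulrDl -addrA mulrDr.
have -> : q%:R * (y%:R / q%:R ^+ l) = v%:R :> R.
  by rewrite mulrA -natrM qyE natrM natrX mulfK // gt_eqF.
by rewrite truncnD ?natrK ?natr_nat // nnegrE mulr_ge0 // addr_ge0.
Qed.

Lemma sum_cell_majorant N L : (N <= L)%N ->
  \sum_(j < q ^ L) cell_majorant N L j = q%:R ^+ (L - N) * total_weight R q ^+ N.
Proof.
elim: N L => [|N IHN] L le_NL.
  rewrite subn0 expr0 mulr1 (eq_bigr (fun=> 1)) => [|j _]; last exact: big_ord0.
  by rewrite sumr_const card_ord natrX.
case: L le_NL => // L; rewrite ltnS => le_NL.
rewrite expnS big_ord_mul exchange_big /= subSS exprSr mulrA -IHN // mulr_suml.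
apply: eq_bigr => j _; rewrite -(sum_pair_weight_shift R q (cell L.+1 j)) mulr_sumr.
apply: eq_bigr => t _; rewrite /cell_majorant big_ord_recl mulrC subn0; congr (_ * _).
  apply: eq_bigr => i _; rewrite lift0 subSS.
  have tq_shift : (q * (t * q ^ L) = t * q ^ i * q * q ^ (L - i))%N.
    have le_iL := leq_trans (ltnW (ltn_ord i)) le_NL.
    by rewrite -{1}(subnKC le_iL) expnD; lia.
  by rewrite (cellD _ tq_shift) pair_weight_modDl.
by rewrite (@cellD _ t) ?[(t + _)%N]addnC // expnS mulnCA.
Qed.

Lemma digit_product_le_cell_majorant N L j alpha : (N <= L)%N ->
  j%:R / q%:R ^+ L <= alpha < j.+1%:R / q%:R ^+ L ->
  digit_product q beta N alpha <= cell_majorant N L j.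
Proof.
move=> le_NL /andP[alpha_ge alpha_lt].
apply: ler_prod => i _; rewrite digit_factor_ge0 /=.
apply: digit_factor_le_pair_weight => //; rewrite /cell; set y := q%:R * (_ / _ + _).
have lt_iL : (i < L)%N by apply: leq_trans (ltn_ord i) le_NL.
have y_ge0 : 0 <= y by rewrite mulr_ge0 // addr_ge0 // divr_ge0 // ltW.
have /andP[trunc_le trunc_gt] := truncn_itv y_ge0.
have qL : q%:R ^+ L = q%:R ^+ (L - i) * q%:R ^+ i :> R by rewrite -exprD subnK // ltnW.
have shift_ge : j%:R / q%:R ^+ (L - i) <= q%:R ^+ i * alpha.
  by rewrite ler_pdivrMr // mulrC mulrA -qL mulrC -ler_pdivrMr.
have shift_lt : q%:R ^+ i * alpha < j.+1%:R / q%:R ^+ (L - i).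
  by rewrite ltr_pdivlMr // mulrC mulrA -qL mulrC -ltr_pdivlMr.
apply/andP; split.
  by apply: le_trans trunc_le _; rewrite /y ler_pM2l // lerD2r.
apply: lt_le_trans (_ : y + 1 <= _); last first.
  by rewrite -natr1 lerD2r ltW.
apply: lt_le_trans (_ : q%:R * (j.+1%:R / q%:R ^+ (L - i) + beta) <= _).
  by rewrite ltr_pM2l // ltrD2r.
rewrite /y -natr1 [(j%:R + 1) / _]mulrDl mul1r !mulrDr addrAC -!addrA !lerD2l.
rewrite ler_pdivrMr // mul1r -[leLHS]expr1 ler_weXn2l ?ler1n //.
by rewrite subn_gt0.
Qed.

End Cells.

(** * Exponential sums with the digit sum character *)

Section DigitExpSum.
Variables (R : realType) (q : nat) (beta : R).
Hypothesis q_gt1 : (1 < q)%N.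

Let q_gt0 : (0 < q)%N. Proof. exact: ltnW. Qed.

Definition digit_char n : R[i] := expi2pi beta ^+ digit_sum q n.

Definition digit_exp_sum Y alpha : R[i] :=
  \sum_(n < Y) digit_char n * expi2pi alpha ^+ n.

Lemma digit_exp_sum_block c M Y alpha : (c < q)%N -> (Y <= q ^ M)%N ->
  \sum_(m < Y) digit_char (c * q ^ M + m) * expi2pi alpha ^+ (c * q ^ M + m) =
  expi2pi (q%:R ^+ M * alpha + beta) ^+ c * digit_exp_sum Y alpha.
Proof.
move=> lt_cq le_YM; rewrite mulr_sumr; apply: eq_bigr => m _.
have lt_mM : (m < q ^ M)%N by apply: leq_trans (ltn_ord m) le_YM.
rewrite /digit_char digit_sum_top // expi2piD -natrX expi2piMn !exprD !exprMn -!exprM.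
by rewrite (mulnC (q ^ M)%N c) mulrACA; congr (_ * _); exact: mulrC.
Qed.

Lemma normc_digit_exp_sum_pow N alpha :
  normc (digit_exp_sum (q ^ N) alpha) = digit_product q beta N alpha.
Proof.
elim: N => [|N IHN].
  rewrite /digit_exp_sum expn0 big_ord1 /digit_char digit_sum0 !expr0 mulr1 normc1.
  by rewrite /digit_product big_ord0.
rewrite /digit_product big_ord_recr /= -/(digit_product _ _ _ _) -IHN -normcM.
congr normc; rewrite {1}/digit_exp_sum expnS.
rewrite (big_ord_mul _ q (q ^ N) (fun n => digit_char n * expi2pi alpha ^+ n)) mulr_sumr.
by apply: eq_bigr => c _; rewrite digit_exp_sum_block // mulrC.
Qed.

Lemma normc_digit_exp_sum_le M Y alpha : (Y < q ^ M)%N ->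
  normc (digit_exp_sum Y alpha) <= q%:R * \sum_(i < M) digit_product q beta i alpha.
Proof.
elim: M Y => [|M IHM] Y lt_YM.
  move: lt_YM; rewrite ltnS leqn0 => /eqP ->.
  by rewrite /digit_exp_sum !big_ord0 normc0 mulr0.
have qM_gt0 : (0 < q ^ M)%N by rewrite expn_gt0 q_gt0.
have lt_top_q : (Y %/ q ^ M < q)%N by rewrite ltn_divLR // -expnS.
have -> : digit_exp_sum Y alpha = \sum_(n < Y %/ q ^ M * q ^ M + Y %% q ^ M)
    digit_char n * expi2pi alpha ^+ n by rewrite -divn_eq.
rewrite big_split_ord /=.
rewrite (big_ord_mul _ _ (q ^ M) (fun n => digit_char n * expi2pi alpha ^+ n)).
rewrite digit_exp_sum_block //; last by rewrite ltnW // ltn_pmod.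
apply: le_trans (le_normcD _ _) _; rewrite normcM normc_expi2piX mul1r.
rewrite big_ord_recr /= mulrDr addrC lerD ?IHM ?ltn_pmod //.
apply: le_trans (normc_sum_le (b := digit_product q beta M alpha) _) _ => [c _|].
  rewrite digit_exp_sum_block //; last exact: ltn_trans lt_top_q.
  by rewrite normcM normc_expi2piX mul1r normc_digit_exp_sum_pow.
by rewrite card_ord ler_wpM2r ?digit_product_ge0 // ler_nat ltnW.
Qed.

Lemma normc_sum_multiples_le d M Y : (0 < d)%N -> (Y < q ^ M)%N ->
  normc (\sum_(n < Y | (d %| n)%N) digit_char n) <=
  q%:R / d%:R * \sum_(h < d) \sum_(i < M) digit_product q beta i (h%:R / d%:R).
Proof.
move=> d_gt0 lt_YM; have dR_gt0 : 0 < d%:R :> R by rewrite ltr0n.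
rewrite mulrAC ler_pdivlMr // mulrC -[d%:R in leLHS](normc_nat R) -normcM.
have -> : d%:R * \sum_(n < Y | (d %| n)%N) digit_char n =
    \sum_(h < d) digit_exp_sum Y (h%:R / d%:R).
  rewrite exchange_big big_mkcond mulr_sumr; apply: eq_bigr => n _.
  rewrite -mulr_sumr sum_expi2pi_rat //.
  by case: ifP => _; rewrite ?mulr0 // mulrC.
apply: le_trans (normc_sum _ _ _) _; rewrite mulr_sumr.
by apply: ler_sum => h _; exact: normc_digit_exp_sum_le.
Qed.

Definition multiples_bound M d : R := 2 * q%:R / d%:R *
  \sum_(h < d) \sum_(i < M) digit_product q beta i (h%:R / d%:R).

Lemma normc_sum_multiples_range_le d M L Z : (0 < d)%N -> (L <= Z)%N ->
  (Z * d < q ^ M)%N ->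
  normc (\sum_(L <= m < Z) digit_char (d * m)) <= multiples_bound M d.
Proof.
move=> d_gt0 le_LZ lt_ZM.
have -> : \sum_(L <= m < Z) digit_char (d * m) =
    \sum_(n < Z * d | (d %| n)%N) digit_char n -
    \sum_(n < L * d | (d %| n)%N) digit_char n.
  rewrite !sum_multiples // -!(big_mkord xpredT (fun m => digit_char (d * m))).
  by rewrite [in RHS](big_cat_nat (leq0n L) le_LZ) /= addrAC subrr add0r.
apply: le_trans (le_normcD _ _) _; rewrite normcN /multiples_bound.
rewrite -!mulrA mulr_natl mulr2n !mulrA lerD //; apply: normc_sum_multiples_le => //.
by apply: leq_ltn_trans lt_ZM; rewrite leq_mul2r le_LZ orbT.
Qed.

End DigitExpSum.

(** * Uniform decay of the digit product *)

Section UniformDecay.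
Variables (R : realType) (q : nat) (beta g rho : R).
Hypothesis q_gt1 : (1 < q)%N.
Hypothesis g_ge0 : 0 <= g.
Hypothesis g_gap : 2 * g * (q%:R + 1) <= normc (1 - expi2pi ((q%:R - 1) * beta)).
Hypothesis rho_gt0 : 0 < rho.
Hypothesis rho_le : rho <= q%:R.
Hypothesis rho_decay : q%:R * (q%:R - g ^+ 2) <= rho ^+ 2.

Lemma digit_factor_le_sub (s : R) :
  digit_factor q s <= q%:R - normc (1 - expi2pi s) ^+ 2 / 4.
Proof.
have -> : digit_factor q s =
    normc (1 + expi2pi s + \sum_(c < q.-2) expi2pi s ^+ c.+2).
  rewrite /digit_factor; case: q q_gt1 => [|[|n]] // _.
  by rewrite !big_ord_recl /= expr0 expr1 addrA.
apply: le_trans (le_normcD _ _) _.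
have tail_le : normc (\sum_(c < q.-2) expi2pi s ^+ c.+2) <= q%:R - 2.
  rewrite -(natrB R q_gt1) -[(q - 2)%:R]mulr1 subn2 -[q.-2 in leRHS]card_ord.
  by apply: normc_sum_le => c _; rewrite normc_expi2piX.
have := normc_1Dexpi2pi_sqr s.
have := normc_ge0 (1 + expi2pi s); have := normc_ge0 (1 - expi2pi s).
move: (normc (1 + _)) (normc (1 - _)) => x t t_ge0 x_ge0 xtE.
suff : x <= 2 - t ^+ 2 / 4 by lra.
have t2_le : t ^+ 2 <= 4 by rewrite -xtE lerDr sqr_ge0.
rewrite -(@ler_pXn2r _ 2) ?nnegrE //; last by lra.
have := sqr_ge0 (t ^+ 2); rewrite (_ : x ^+ 2 = 4 - t ^+ 2); last by lra.
by move: (t ^+ 2) => u; nra.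
Qed.

(* The numbers s and q s - (q - 1) beta cannot both be close to an integer,
   because (q - 1) beta is not. *)
Lemma digit_factor_consecutive_le s :
  digit_factor q s * digit_factor q (q%:R * s - (q%:R - 1) * beta) <=
  q%:R * (q%:R - g ^+ 2).
Proof.
set s' := _ * s - _; pose w := expi2pi ((q%:R - 1) * beta).
have qR_gt0 : 0 < q%:R :> R by rewrite ltr0n ltnW.
have gap_le : normc (1 - w) <=
    q%:R * normc (1 - expi2pi s) + normc (1 - expi2pi s').
  have wE : expi2pi s' * w = expi2pi s ^+ q by rewrite /w -expi2piD subrK expi2piMn.
  have -> : 1 - w = (1 - expi2pi s ^+ q) + (expi2pi s' - 1) * w.
    by rewrite mulrBl mul1r wE addrA subrK.
  apply: le_trans (le_normcD _ _) _; apply: lerD; last first.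
    by rewrite normcM normc_expi2pi mulr1 -opprB normcN.
  rewrite -[1 - _ ^+ _]opprB normcN subrX1 normcM mulrC -[expi2pi s - 1]opprB normcN.
  by rewrite ler_wpM2r ?normc_ge0 // digit_factor_le.
have far_le u : 2 * g <= normc (1 - expi2pi u) -> digit_factor q u <= q%:R - g ^+ 2.
  move=> g_le; apply: le_trans (digit_factor_le_sub u) _; rewrite lerD2l lerN2.
  have : (2 * g) ^+ 2 <= normc (1 - expi2pi u) ^+ 2.
    by rewrite ler_pXn2r ?nnegrE ?normc_ge0 // mulr_ge0.
  by rewrite exprMn; lra.
have [s_far|s_near] := leP (2 * g) (normc (1 - expi2pi s)).
  by rewrite mulrC ler_pM ?digit_factor_ge0 ?digit_factor_le ?far_le.
rewrite ler_pM ?digit_factor_ge0 ?digit_factor_le ?far_le //.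
have := ler_wpM2l (ltW qR_gt0) (ltW s_near); rewrite [leRHS]mulrC.
by have := le_trans g_gap gap_le; rewrite mulrDr mulr1; lra.
Qed.

Lemma digit_product_decay N alpha :
  digit_product q beta N alpha <= q%:R / rho * rho ^+ N.
Proof.
have [m lt_Nm] := ubnP N; elim: m N lt_Nm => // m IHm [|[|N]] lt_Nm.
- by rewrite /digit_product big_ord0 expr0 mulr1 ler_pdivlMr // mul1r.
- by rewrite /digit_product big_ord1 expr1 divfK ?gt_eqF // digit_factor_le.
rewrite /digit_product 2!big_ord_recr /= -mulrA -/(digit_product q beta N alpha).
rewrite -[N.+2]addn2 exprD [leRHS]mulrA.
apply: ler_pM; rewrite ?digit_product_ge0 ?mulr_ge0 ?digit_factor_ge0 //.
  by apply: IHm; rewrite -ltnS ltnW // ltnW.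
have -> : q%:R ^+ N.+1 * alpha + beta =
    q%:R * (q%:R ^+ N * alpha + beta) - (q%:R - 1) * beta by rewrite exprS; ring.
exact: le_trans (digit_factor_consecutive_le _) rho_decay.
Qed.

End UniformDecay.

Definition residue_gap (R : realType) (q p : nat) : R := (p%:R * (q%:R + 1))^-1.

Lemma residue_gap_ge0 (R : realType) q p : 0 <= residue_gap R q p.
Proof. by rewrite invr_ge0 mulr_ge0 ?addr_ge0. Qed.

Lemma residue_gap_le (R : realType) (q p b : nat) : (1 < q)%N -> (0 < b < p)%N ->
  coprime (q - 1) p ->
  2 * residue_gap R q p * (q%:R + 1) <=
    normc (1 - expi2pi ((q%:R - 1) * (b%:R / p%:R))).
Proof.
move=> q_gt1 /andP[b_gt0 lt_bp] coprime_qp.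
have -> : (q%:R - 1) * (b%:R / p%:R) = ((q - 1) * b)%:R / p%:R :> R.
  by rewrite natrM natrB 1?ltnW // mulrA.
have p_ndvd : ~~ (p %| (q - 1) * b)%N.
  by rewrite Gauss_dvdr 1?coprime_sym // gtnNdvd.
have := normc_1Bexpi2pi_rat R p_ndvd; congr (_ <= _).
by rewrite /residue_gap invfM mulrA -mulrA mulVf // mulr1.
Qed.

(** * Summation over Farey fractions *)

Lemma leq_mul_of_eq_divn T a r a' r' : (0 < r)%N -> (0 < r')%N -> (r * r' <= T)%N ->
  (a * T %/ r = a' * T %/ r')%N -> (a * r' <= a' * r)%N.
Proof.
move=> r_gt0 r'_gt0 le_rrT eq_div; rewrite leqNgt; apply/negP => lt_a.
have ceil_a := ltn_ceil (a * T) r_gt0; have floor_a' := leq_divM (a' * T) r'.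
move: ceil_a floor_a'; rewrite eq_div; set j := (a' * T %/ r')%N => ceil_a floor_a'.
have gap_T : ((a' * r + 1) * T <= a * r' * T)%N by rewrite leq_mul2r addn1 lt_a orbT.
have ceil_mul : (a * T * r' < j.+1 * r * r')%N by rewrite ltn_mul2r r'_gt0.
have floor_mul : (j * r' * r <= a' * T * r)%N by rewrite leq_mul2r floor_a' orbT.
lia.
Qed.

Lemma coprime_cross_mul_inj a r a' r' : (0 < r)%N ->
  coprime a r -> coprime a' r' -> (a * r' = a' * r)%N -> a = a' /\ r = r'.
Proof.
move=> r_gt0 coprime_ar coprime_ar' crossE.
have rE : r = r'.
  apply/eqP; rewrite eqn_dvd; apply/andP; split.
    by rewrite -(@Gauss_dvdr _ a) 1?coprime_sym // crossE dvdn_mull.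
  by rewrite -(@Gauss_dvdr _ a') 1?coprime_sym // -crossE dvdn_mull.
by split=> //; move/eqP: crossE; rewrite rE eqn_pmul2r -?rE // => /eqP.
Qed.

Lemma farey_cell_inj T a r a' r' : (0 < r)%N -> (0 < r')%N -> (r * r' <= T)%N ->
  coprime a r -> coprime a' r' ->
  (a * T %/ r = a' * T %/ r')%N -> a = a' /\ r = r'.
Proof.
move=> r_gt0 r'_gt0 le_rrT coprime_ar coprime_ar' eq_div.
apply: coprime_cross_mul_inj => //; apply/eqP; rewrite eqn_leq.
by rewrite (leq_mul_of_eq_divn _ _ _ eq_div) // (leq_mul_of_eq_divn _ _ _ (esym eq_div)) // mulnC.
Qed.

(* Distinct reduced fractions with denominators at most Q differ by at least
   Q^-2, so they lie in distinct cells [j / T, (j + 1) / T[ when Q^2 <= T. *)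
Lemma farey_sum_le_cells (R : realType) Q T (g : R -> R) (c : nat -> R) :
  (Q * Q <= T)%N -> (forall j, 0 <= c j) ->
  (forall j alpha, j%:R / T%:R <= alpha < j.+1%:R / T%:R -> g alpha <= c j) ->
  \sum_(1 <= r < Q.+1) \sum_(a < r | coprime a r) g (a%:R / r%:R) <= \sum_(j < T) c j.
Proof.
move=> le_QT c_ge0 g_le; have [->|Q_gt0] := posnP Q.
  by rewrite big_geq //; exact: sumr_ge0.
have T_gt0 : (0 < T)%N by rewrite (leq_trans _ le_QT) // muln_gt0 Q_gt0.
pose reduced : {pred 'I_Q.+1 * 'I_Q.+1} :=
  [pred x : 'I_Q.+1 * 'I_Q.+1 | [&& (0 < x.1)%N, coprime x.2 x.1 & (x.2 < x.1)%N]].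
have -> : \sum_(1 <= r < Q.+1) \sum_(a < r | coprime a r) g (a%:R / r%:R) =
    \sum_(x in reduced) g (x.2%:R / x.1%:R).
  rewrite big_geq_mkord -(pair_big_dep (fun r : 'I_Q.+1 => 0 < r)%N
    (fun r a : 'I_Q.+1 => coprime a r && (a < r)%N) (fun r a => g (a%:R / r%:R))) /=.
  apply: eq_bigr => r _.
  exact: (big_ord_widen_cond _ (fun a => coprime a r) (fun a => g (a%:R / r%:R))
    (ltnW (ltn_ord r))).
pose f (x : 'I_Q.+1 * 'I_Q.+1) : 'I_T := Ordinal (ltn_pmod (x.2 * T %/ x.1) T_gt0).
have fE x : x \in reduced -> f x = (x.2 * T %/ x.1)%N :> nat.
  move=> /and3P[r_gt0 _ lt_ar].
  by rewrite /= modn_small // ltn_divLR // mulnC ltn_mul2l T_gt0.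
apply: (@ler_sum_inj R _ _ reduced f _ (fun j => c j)) => //.
- move=> x y x_red y_red /(congr1 (@nat_of_ord T)); rewrite !fE //.
  case: x y x_red y_red => r a [r' a'] /and3P[/= r_gt0 coprime_ar _].
  move=> /and3P[/= r'_gt0 coprime_ar' _] eq_div.
  have le_rrT : (r * r' <= T)%N.
    by apply: leq_trans le_QT; rewrite leq_mul // -ltnS.
  have [aE rE] := farey_cell_inj r_gt0 r'_gt0 le_rrT coprime_ar coprime_ar' eq_div.
  by congr pair; exact: val_inj.
move=> x x_red; apply: g_le; rewrite fE //; move: x_red => /and3P[r_gt0 _ _].
rewrite ler_pdivrMr ?ltr0n // mulrAC ler_pdivlMr ?ltr0n // -!natrM ler_nat leq_divM.
by rewrite ltr_pdivlMr ?ltr0n // mulrAC ltr_pdivrMr ?ltr0n // -!natrM ltr_nat ltn_ceil.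
Qed.

Lemma sum_gcd_eq (R : numFieldType) (V : nmodType) e r (g : R -> V) : (0 < e)%N ->
  \sum_(h < r * e | gcdn h (r * e) == e) g (h%:R / (r * e)%:R) =
  \sum_(a < r | coprime a r) g (a%:R / r%:R).
Proof.
move=> e_gt0; pose F h := if gcdn h (r * e) == e then g (h%:R / (r * e)%:R) else 0.
have -> : \sum_(h < r * e | gcdn h (r * e) == e) g (h%:R / (r * e)%:R) =
    \sum_(h < r * e | (e %| h)%N) F h.
  rewrite [LHS]big_mkcond [RHS]big_mkcond; apply: eq_bigr => h _ /=; rewrite /F.
  case: eqP => [gcdE|_]; last by case: ifP.
  by rewrite -[X in (X %| _)%N]gcdE dvdn_gcdl.
rewrite sum_multiples // [RHS]big_mkcond; apply: eq_bigr => a _.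
rewrite /F mulnC -muln_gcdl -[X in _ == X]mul1n eqn_pmul2r //.
by rewrite !natrM -mulf_div divff ?mulr1 // pnatr_eq0 -lt0n.
Qed.

Lemma partition_lowest_terms (R : numFieldType) (V : nmodType) d (g : R -> V) :
  (0 < d)%N ->
  \sum_(h < d) g (h%:R / d%:R) =
  \sum_(r < d.+1 | (r %| d)%N) \sum_(a < r | coprime a r) g (a%:R / r%:R).
Proof.
move=> d_gt0; pose denom (h : 'I_d) : 'I_d.+1 := inord (d %/ gcdn h d).
have denomE h : denom h = (d %/ gcdn h d)%N :> nat by rewrite inordK // ltnS leq_div.
rewrite (partition_big denom (fun r => r %| d)%N) /= => [|h _]; last first.
  by rewrite denomE; apply/dvdnP; exists (gcdn h d); rewrite mulnC divnK // dvdn_gcdr.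
apply: eq_bigr => r /dvdnP[e dE].
have /andP[e_gt0 r_gt0] : (0 < e)%N && (0 < r)%N by rewrite -muln_gt0 -dE.
have denom_eq h : (denom h == r) = (gcdn h d == e).
  have gcd_gt0 : (0 < gcdn h d)%N by rewrite gcdn_gt0 d_gt0 orbT.
  rewrite -val_eqE /= denomE -(eqn_pmul2r gcd_gt0) divnK ?dvdn_gcdr // {1}dE mulnC.
  by rewrite eqn_pmul2l // eq_sym.
under eq_bigl => h do rewrite denom_eq.
by have := sum_gcd_eq r g e_gt0; rewrite mulnC -dE.
Qed.

Lemma sum_inv_multiples_le (R : numFieldType) D r : (0 < r)%N ->
  \sum_(1 <= d < D.+1 | (r %| d)%N) (d%:R^-1 : R) <=
  r%:R^-1 * \sum_(1 <= e < D.+1) e%:R^-1.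
Proof.
move=> r_gt0; pose F n := n%:R^-1 : R.
have F_ge0 n : 0 <= F n by rewrite invr_ge0.
apply: (@le_trans _ _ (\sum_(d < D.+1 * r | (r %| d)%N) F d)).
  rewrite -(big_mkord (fun d => r %| d)%N F) [leRHS](big_cat_nat (n := 1)) ?muln_gt0 //=.
  rewrite [X in _ + X](big_cat_nat (n := D.+1)) ?leq_pmulr //= addrCA lerDl.
  by rewrite addr_ge0 // sumr_ge0.
rewrite sum_multiples // mulr_sumr -(big_mkord xpredT (fun m => F (r * m)%N)).
rewrite big_ltn // /F muln0 invr0 add0r ler_sum // => m _.
by rewrite natrM invfM.
Qed.

Lemma sum_lowest_terms_le (R : numFieldType) D (g : R -> R) : (forall x, 0 <= g x) ->
  \sum_(1 <= d < D.+1) d%:R^-1 * \sum_(h < d) g (h%:R / d%:R) <=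
  (\sum_(1 <= e < D.+1) e%:R^-1) *
  \sum_(1 <= r < D.+1) r%:R^-1 * \sum_(a < r | coprime a r) g (a%:R / r%:R).
Proof.
move=> g_ge0; pose f r := \sum_(a < r | coprime a r) g (a%:R / r%:R).
have f_ge0 r : 0 <= f r by exact: sumr_ge0.
have -> : \sum_(1 <= d < D.+1) d%:R^-1 * \sum_(h < d) g (h%:R / d%:R) =
    \sum_(1 <= r < D.+1) (\sum_(1 <= d < D.+1 | (r %| d)%N) d%:R^-1) * f r.
  under [RHS]eq_bigr do rewrite mulr_suml.
  rewrite (exchange_big_dep xpredT) //=; apply: eq_big_nat => d /andP[d_gt0 le_dD].
  rewrite partition_lowest_terms // -mulr_sumr; congr (_ * _).
  rewrite -[LHS](big_mkord (fun r => r %| d)%N f).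
  rewrite [LHS]big_mkcond big_ltn // dvd0n gtn_eqF //= add0r -big_mkcond.
  rewrite (big_nat_widen _ _ _ _ _ le_dD); apply: eq_bigl => r /=.
  by rewrite ltnS andb_idr // => /dvdn_leq; apply.
rewrite mulr_sumr; apply: ler_sum_nat => r /andP[r_gt0 _].
by rewrite mulrA [_ * r%:R^-1]mulrC ler_wpM2r // sum_inv_multiples_le.
Qed.

Section FareyMeanValue.
Variables (R : realType) (q : nat) (beta C rho A : R).
Hypothesis q_gt1 : (1 < q)%N.
Hypothesis beta_ge0 : 0 <= beta.
Hypothesis rho_ge1 : 1 <= rho.
Hypothesis decay : forall N alpha, digit_product q beta N alpha <= C * rho ^+ N.
Hypothesis weight_le_rho : total_weight R q ^+ 2 <= q%:R * rho ^+ 2.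
Hypothesis A_ge1 : 1 <= A.
Hypothesis weight_le_A : total_weight R q / q%:R <= A.

Let q_gt0 : (0 < q)%N. Proof. exact: ltnW. Qed.
Let qR_gt0 : 0 < q%:R :> R. Proof. by rewrite ltr0n. Qed.
Let qX_gt0 n : 0 < q%:R ^+ n :> R. Proof. exact: exprn_gt0. Qed.
Let rho_ge0 : 0 <= rho. Proof. exact: le_trans rho_ge1. Qed.
Let C_ge0 : 0 <= C.
Proof. by have := decay 0 0; rewrite /digit_product big_ord0 mulr1; apply: le_trans. Qed.
Local Notation G := (digit_product q beta).
Local Notation w := (total_weight R q).
Let wq_ge0 : 0 <= w / q%:R. Proof. by rewrite divr_ge0 ?total_weight_ge0. Qed.

Definition farey_sum n r : R := \sum_(a < r | coprime a r) G n (a%:R / r%:R).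

Lemma farey_sum_ge0 n r : 0 <= farey_sum n r.
Proof. by apply: sumr_ge0 => a _; exact: digit_product_ge0. Qed.

Lemma sum_farey_sum_short i n : (n <= i.*2.+2)%N ->
  \sum_(1 <= r < (q ^ i.+1).+1) farey_sum n r <= q%:R ^+ i.*2.+2 * (w / q%:R) ^+ n.
Proof.
move=> le_n.
have -> : q%:R ^+ i.*2.+2 * (w / q%:R) ^+ n = q%:R ^+ (i.*2.+2 - n) * w ^+ n.
  by rewrite -[in LHS](subnK le_n) exprD -mulrA -exprMn [q%:R * _]mulrC divfK // gt_eqF.
rewrite -(sum_cell_majorant q_gt0 beta_ge0 le_n).
apply: farey_sum_le_cells => [|j|j alpha].
- by rewrite -expnD leq_exp2l // -addnn !addSn !addnS.
- exact: cell_majorant_ge0.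
- by rewrite natrX; exact: digit_product_le_cell_majorant.
Qed.

Lemma sum_farey_sum_long i n : (i.*2.+2 <= n)%N ->
  \sum_(1 <= r < (q ^ i.+1).+1) farey_sum n r <=
  w ^+ i.*2.+2 * (C * rho ^+ (n - i.*2.+2)).
Proof.
move=> le_n; have := sum_farey_sum_short (leqnn i.*2.+2).
rewrite -exprMn [q%:R * _]mulrC divfK ?gt_eqF // => short_le.
have decay_ge0 : 0 <= C * rho ^+ (n - i.*2.+2) by rewrite mulr_ge0 ?exprn_ge0.
apply: le_trans (ler_wpM2r decay_ge0 short_le).
rewrite mulr_suml ler_sum // => r _; rewrite mulr_suml ler_sum // => a _.
by rewrite -[in leLHS](subnKC le_n) digit_productD ler_wpM2l ?digit_product_ge0.
Qed.

Lemma farey_block_le_total i n :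
  \sum_(q ^ i <= r < q ^ i.+1) r%:R^-1 * farey_sum n r <=
  q%:R ^- i * \sum_(1 <= r < (q ^ i.+1).+1) farey_sum n r.
Proof.
have qi_gt0 : (0 < q ^ i)%N by rewrite expn_gt0 q_gt0.
apply: (@le_trans _ _ (q%:R ^- i * \sum_(q ^ i <= r < q ^ i.+1) farey_sum n r)).
  rewrite mulr_sumr; apply: ler_sum_nat => r /andP[le_qr _].
  rewrite ler_wpM2r ?farey_sum_ge0 // lef_pV2 ?posrE // -?natrX ?ler_nat //.
  by rewrite ltr0n (leq_trans qi_gt0).
rewrite ler_pM2l ?invr_gt0 // [leRHS](big_cat_nat (n := (q ^ i)%N)) //=; last first.
  by rewrite ltnW // ltnS leq_exp2l.
rewrite [X in _ + X](big_cat_nat (n := (q ^ i.+1)%N)) ?leq_exp2l //= addrCA lerDl.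
by rewrite addr_ge0 // sumr_ge0 // => r _; exact: farey_sum_ge0.
Qed.

Lemma farey_block_le i n D : (q ^ i <= D)%N ->
  \sum_(q ^ i <= r < q ^ i.+1) r%:R^-1 * farey_sum n r <=
  q%:R ^+ 2 * D%:R * (w / q%:R) ^+ n + q%:R * C * rho ^+ n.
Proof.
move=> le_qD; apply: le_trans (farey_block_le_total i n) _.
have [le_n|lt_n] := leqP n i.*2.+2.
  rewrite -[leLHS]addr0 lerD ?mulr_ge0 ?exprn_ge0 //.
  rewrite ler_pdivrMl //; apply: le_trans (sum_farey_sum_short le_n) _.
  rewrite mulrA ler_wpM2r ?exprn_ge0 // mulrCA -addnn -add2n !exprD.
  by rewrite !ler_pM2l // -natrX ler_nat.
rewrite -[leLHS]add0r lerD ?mulr_ge0 ?exprn_ge0 //.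
rewrite ler_pdivrMl //; apply: le_trans (sum_farey_sum_long (ltnW lt_n)) _.
have w_pow_le : w ^+ i.*2.+2 <= (q%:R * rho ^+ 2) ^+ i.+1.
  rewrite -doubleS -mul2n exprM lerXn2r ?nnegrE ?mulr_ge0 ?exprn_ge0 ?total_weight_ge0 //.
apply: le_trans (ler_wpM2r _ w_pow_le) _; first by rewrite mulr_ge0 ?exprn_ge0.
rewrite exprMn -exprM mul2n doubleS -[in leRHS](subnKC (ltnW lt_n)) exprD exprS.
by rewrite le_eqVlt; apply/orP; left; apply/eqP; ring.
Qed.

Lemma sum_expn_blocks (V : nmodType) m (F : nat -> V) :
  \sum_(1 <= r < q ^ m) F r = \sum_(i < m) \sum_(q ^ i <= r < q ^ i.+1) F r.
Proof.
elim: m => [|m IHm]; first by rewrite big_ord0 big_geq.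
rewrite big_ord_recr /= -IHm -big_cat_nat ?expn_gt0 ?q_gt0 //.
by rewrite leq_exp2l.
Qed.

Lemma farey_mean_value n D : (0 < D)%N ->
  \sum_(1 <= r < D.+1) r%:R^-1 * farey_sum n r <=
  (trunc_log q D).+1%:R *
    (q%:R ^+ 2 * D%:R * (w / q%:R) ^+ n + q%:R * C * rho ^+ n).
Proof.
move=> D_gt0; have /andP[log_le lt_log] := trunc_log_bounds q_gt1 D_gt0.
have term_ge0 r : 0 <= r%:R^-1 * farey_sum n r.
  by rewrite mulr_ge0 ?invr_ge0 ?farey_sum_ge0.
apply: (@le_trans _ _ (\sum_(1 <= r < q ^ (trunc_log q D).+1) r%:R^-1 * farey_sum n r)).
  by rewrite [leRHS](big_cat_nat (n := D.+1)) //= lerDl sumr_ge0.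
rewrite sum_expn_blocks mulr_natl -[X in _ *+ X]card_ord -sumr_const ler_sum // => i _.
by apply: farey_block_le; apply: leq_trans log_le; rewrite leq_exp2l // -ltnS.
Qed.

Lemma sum_multiples_bound_le M D : (0 < D)%N ->
  \sum_(1 <= d < D.+1) multiples_bound q beta M d <=
  2 * q%:R * ((1 + ln D%:R) * (trunc_log q D).+1%:R * M%:R *
    (q%:R ^+ 2 * D%:R * A ^+ M + q%:R * C * rho ^+ M)).
Proof.
move=> D_gt0.
have -> : \sum_(1 <= d < D.+1) multiples_bound q beta M d =
    2 * q%:R * \sum_(n < M) \sum_(1 <= d < D.+1) d%:R^-1 * \sum_(h < d) G n (h%:R / d%:R).
  rewrite exchange_big mulr_sumr; apply: eq_bigr => d _.
  by rewrite /multiples_bound -mulrA exchange_big [d%:R^-1 * _]mulr_sumr.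
rewrite ler_wpM2l ?mulr_ge0 //.
set E := (X in _ * M%:R * X); rewrite mulrAC.
have term_le (n : 'I_M) : \sum_(1 <= d < D.+1) d%:R^-1 * \sum_(h < d) G n (h%:R / d%:R) <=
    (1 + ln D%:R) * (trunc_log q D).+1%:R * E.
  apply: le_trans (sum_lowest_terms_le D (digit_product_ge0 q beta n)) _.
  rewrite -mulrA ler_pM ?harmonic_sum_le //.
  - by apply: sumr_ge0 => e _; rewrite invr_ge0.
  - by apply: sumr_ge0 => r _; rewrite mulr_ge0 ?invr_ge0 ?farey_sum_ge0.
  apply: le_trans (farey_mean_value n D_gt0) _; rewrite ler_wpM2l //.
  have le_nM := ltnW (ltn_ord n).
  rewrite lerD ?ler_wpM2l ?mulr_ge0 ?exprn_ge0 ?ler_weXn2l //.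
  apply: le_trans (ler_weXn2l A_ge1 le_nM).
  by rewrite lerXn2r ?nnegrE // (le_trans _ A_ge1).
apply: le_trans (ler_sum _ (fun n _ => term_le n)) _.
by rewrite sumr_const card_ord -[leLHS]mulr_natr.
Qed.

End FareyMeanValue.

Definition twisted_tau_sum (R : realType) q (beta : R) k X : R[i] :=
  \sum_(1 <= n < X.+1) digit_char q beta n *+ tau k n.

Lemma normc_twisted_tau_sum_le (R : realType) q (beta : R) k X M D (W : R) :
  (1 < q)%N -> (X.*2 < q ^ M)%N -> (0 < D)%N -> (D <= X)%N ->
  (forall d, (d ^ k.+1 <= X ^ k)%N -> (d <= D)%N) ->
  (forall d, (0 < d <= D)%N -> (tau k d)%:R <= W) ->
  normc (twisted_tau_sum q beta k.+1 X) <=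
  k.+1%:R * (W * \sum_(1 <= d < D.+1) multiples_bound q beta M d).
Proof.
move=> q_gt1 lt_XM D_gt0 le_DX le_D tau_le.
have bound_ge0 d : 0 <= multiples_bound q beta M d.
  rewrite mulr_ge0 ?divr_ge0 ?mulr_ge0 //.
  by apply: sumr_ge0 => h _; apply: sumr_ge0 => i _; exact: digit_product_ge0.
apply: le_trans (@norm_sum_tau_le R (Rcomplex R) k X _ (multiples_bound q beta M) _) _.
  move=> d L d_gt0 L_gt0 le_dL; have le_LX : (L <= X %/ d)%N by rewrite leq_divRL // mulnC.
  apply: normc_sum_multiples_range_le => //; first exact: leqW.
  apply: leq_ltn_trans lt_XM; rewrite -addnn mulSn leq_add ?leq_divM //.
  exact: leq_trans (leq_pmulr _ L_gt0) le_dL.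
rewrite ler_wpM2l //.
have W_ge0 : 0 <= W by apply: le_trans (tau_le 1%N _) => //; rewrite D_gt0.
rewrite mulr_sumr [leRHS](@big_nat_widen _ _ _ _ _ X.+1) // /= [leLHS]big_mkcond [leRHS]big_mkcond.
apply: ler_sum_nat => d /andP[d_gt0 _]; case: ifP => [/le_D le_dD|_].
  by rewrite ltnS le_dD -[leLHS]mulr_natl ler_wpM2r // tau_le ?d_gt0.
by case: ifP => // _; exact: mulr_ge0.
Qed.

(** * Bounds by powers of x *)

Lemma tau_le_powR (R : realType) k (eta : R) : 0 < eta ->
  exists2 C, 0 <= C & forall n, (0 < n)%N -> (tau k n)%:R <= C * n%:R `^ eta.
Proof.
move=> eta_gt0; pose J := (Num.truncn eta^-1).+1.
have invJ_le : J%:R^-1 <= eta by rewrite invf_ple ?posrE // ltW // /J truncnS_gt.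
have [c div_le] := divisor_bound (k * J)%N.
exists (c%:R `^ J%:R^-1) => [|n n_gt0]; first exact: powR_ge0.
have tauX_le : (tau k n)%:R ^+ J <= c%:R * n%:R :> R.
  rewrite -natrX -natrM ler_nat; apply: leq_trans (div_le n n_gt0).
  by rewrite expnM leq_exp2r // tau_le_divisors.
have -> : (tau k n)%:R = ((tau k n)%:R ^+ J) `^ J%:R^-1 :> R.
  by rewrite -powR_mulrn // -powRrM divff ?gt_eqF // powRr1.
apply: (@le_trans _ _ ((c%:R * n%:R) `^ J%:R^-1)).
  by apply: ge0_ler_powR; rewrite ?nnegrE ?invr_ge0 ?mulr_ge0 ?exprn_ge0 // ltW.
by rewrite powRM // ler_wpM2l ?powR_ge0 // ler_powR // ler1n.
Qed.

Section PowerBounds.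
Variable R : realType.
Implicit Types b s t x y : R.

Lemma powRD_gt0 x s t : 0 < x -> x `^ (s + t) = x `^ s * x `^ t.
Proof. by move=> x_gt0; rewrite powRD //; apply/implyP => _; rewrite gt_eqF. Qed.

Lemma powR_ge1 x s : 1 <= x -> 0 <= s -> 1 <= x `^ s.
Proof. by move=> x_ge1 s_ge0; rewrite -(powRr0 x) ler_powR. Qed.

Lemma ln1D_le_powR eta x : 0 < eta -> 1 <= x -> 1 + ln x <= (1 + eta^-1) * x `^ eta.
Proof.
move=> eta_gt0 x_ge1; have x_gt0 : 0 < x by apply: lt_le_trans x_ge1.
rewrite mulrDl mul1r lerD ?powR_ge1 ?(ltW eta_gt0) //.
rewrite mulrC ler_pdivlMr // mulrC -ln_powR ltW // ln_sublinear //.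
exact: powR_gt0.
Qed.

Lemma nat_le_powR k d X x : X%:R <= x -> (d ^ k.+1 <= X ^ k)%N ->
  d%:R <= x `^ (1 - k.+1%:R^-1).
Proof.
move=> le_Xx le_d; have x_ge0 : 0 <= x by apply: le_trans le_Xx.
have -> : 1 - k.+1%:R^-1 = k%:R / k.+1%:R :> R.
  by rewrite -[k%:R](addrK 1) natr1 mulrBl divff ?gt_eqF // mul1r.
have -> : d%:R = (d%:R ^+ k.+1) `^ k.+1%:R^-1 :> R.
  by rewrite -powR_mulrn // -powRrM divff ?gt_eqF // powRr1.
rewrite powRrM powR_mulrn // ge0_ler_powR ?nnegrE ?invr_ge0 ?exprn_ge0 //.
by apply: le_trans (lerXn2r k _ _ le_Xx); rewrite ?nnegrE // -!natrX ler_nat.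
Qed.

Lemma powR_exp_trunc_log q X s : (1 < q)%N -> (0 < X)%N -> 0 <= s ->
  (q%:R `^ s) ^+ trunc_log q X <= X%:R `^ s.
Proof.
move=> q_gt1 X_gt0 s_ge0; have /andP[log_le _] := trunc_log_bounds q_gt1 X_gt0.
rewrite -powR_mulrn ?powR_ge0 // powRAC powR_mulrn //.
by rewrite ge0_ler_powR ?nnegrE ?exprn_ge0 // -natrX ler_nat.
Qed.

Lemma exists_powR_sqr_ge b y : 1 < b -> y < b ^+ 2 ->
  exists2 mu, 0 < mu < 1 & y <= (b `^ mu) ^+ 2.
Proof.
move=> b_gt1 lt_yb; pose t := Num.max b y.
have b_gt0 : 0 < b by apply: lt_trans b_gt1.
have lnb_gt0 : 0 < ln b by exact: ln_gt0.
have t_gt1 : 1 < t by rewrite lt_max b_gt1.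
have t_gt0 : 0 < t by apply: lt_trans t_gt1.
have t_lt : t < b ^+ 2 by rewrite gt_max lt_yb expr2 ltr_pMr ?b_gt1.
exists (ln t / (2 * ln b)).
  rewrite divr_gt0 ?ln_gt0 ?mulr_gt0 //= ltr_pdivrMr ?mulr_gt0 // mul1r.
  by rewrite mulr_natl -lnXn // ltr_ln ?posrE ?exprn_gt0.
have -> : (b `^ (ln t / (2 * ln b))) ^+ 2 = t; last by rewrite le_max lexx orbT.
rewrite -powR_mulrn ?powR_ge0 // -powRrM /powR gt_eqF //.
by rewrite (_ : _ * ln b = ln t) ?lnK //; field; rewrite gt_eqF.
Qed.

End PowerBounds.

Section Exponents.
Variables (R : realType) (p q : nat).
Hypothesis p_gt0 : (0 < p)%N.
Hypothesis q_gt1 : (1 < q)%N.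
Hypothesis theta_lt : theta q < 2^-1 :> R.

Let q_gt0 : (0 < q)%N. Proof. exact: ltnW. Qed.
Let qR_gt0 : 0 < q%:R :> R. Proof. by rewrite ltr0n. Qed.
Let lnq_gt0 : 0 < ln q%:R :> R. Proof. by rewrite ln_gt0 // ltr1n. Qed.
Let six_lnq_ge : 6 <= 6 * (1 + ln q%:R) :> R. Proof. by have := lnq_gt0; lra. Qed.

Lemma theta_ge0 : 0 <= theta q :> R.
Proof. by rewrite divr_ge0 ?ln_ge0 ?ler1n //; have := six_lnq_ge; lra. Qed.

Lemma ln_base_ge1 : 1 <= ln q%:R :> R.
Proof.
have ln6_ge : 5 / 6 <= ln 6 :> R.
  have : ln (1 + - (5 / 6)) <= - (5 / 6) :> R by apply: le_ln1Dx; lra.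
  rewrite (_ : 1 + - (5 / 6) = 6^-1); last by field.
  by rewrite lnV ?posrE // lerN2.
have : ln 6 <= ln (6 * (1 + ln q%:R)) :> R.
  by rewrite ler_ln ?posrE //; have := six_lnq_ge; lra.
by move: theta_lt; rewrite /theta ltr_pdivrMr //; lra.
Qed.

Lemma powR_theta : q%:R `^ theta q = 6 * (1 + ln q%:R) :> R.
Proof.
rewrite /powR gt_eqF // /theta divfK ?gt_eqF // lnK // posrE.
by have := six_lnq_ge; lra.
Qed.

Lemma total_weight_le_theta : total_weight R q / q%:R <= q%:R `^ theta q.
Proof.
rewrite powR_theta ler_pdivrMr //; apply: le_trans (total_weight_le R q_gt0) _.
have := ln_base_ge1; move: (ln _) => l l_ge1.
by rewrite -mulrA mulrCA [leRHS]mulrC ler_pM2l //; lra.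
Qed.

Lemma exists_decay_exponent : exists2 mu : R, 0 < mu < 1 &
  q%:R * (q%:R - residue_gap R q p ^+ 2) <= (q%:R `^ mu) ^+ 2 /\
  total_weight R q ^+ 2 <= q%:R * (q%:R `^ mu) ^+ 2.
Proof.
pose y := Num.max (q%:R * (q%:R - residue_gap R q p ^+ 2)) (total_weight R q ^+ 2 / q%:R).
have [||mu mu01] := @exists_powR_sqr_ge R q%:R y; first by rewrite ltr1n.
  rewrite gt_max; apply/andP; split.
    rewrite [ltRHS]expr2 ltr_pM2l // ltrBlDr ltrDl exprn_gt0 //.
    by rewrite invr_gt0 mulr_gt0 ?ltr0n // addr_gt0.
  have theta2_lt : (q%:R `^ theta q) ^+ 2 < q%:R :> R.
    rewrite -powR_mulrn ?powR_ge0 // -powRrM -[ltRHS]powRr1 ?ltW //.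
    by rewrite /powR gt_eqF // ltr_expR ltr_pM2r //; move: theta_lt; lra.
  have weight_le : total_weight R q <= q%:R * q%:R `^ theta q.
    by rewrite mulrC -ler_pdivrMr // total_weight_le_theta.
  rewrite ltr_pdivrMr //; apply: (@le_lt_trans _ _ ((q%:R * q%:R `^ theta q) ^+ 2)).
    by rewrite lerXn2r ?nnegrE ?total_weight_ge0 // mulr_ge0 ?powR_ge0.
  by rewrite exprMn ltr_pM2l // exprn_gt0.
rewrite ge_max => /andP[decay_le weight_le]; exists mu => //; split=> //.
by rewrite mulrC -ler_pdivrMr.
Qed.

Section LargeX.
Variables (x : R) (mu kappa : R).
Hypothesis x_ge1 : 1 <= x.
Hypothesis mu_ge0 : 0 <= mu.
Hypothesis kappa01 : 0 <= kappa <= 1.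

Local Notation X := (Num.truncn x).
Local Notation D := (Num.truncn (x `^ kappa)).
Local Notation M := (trunc_log q X).+2.
Local Notation A := (q%:R `^ theta q : R).
Local Notation rho := (q%:R `^ mu : R).

Let x_gt0 : 0 < x. Proof. exact: lt_le_trans x_ge1. Qed.
Let X_gt0 : (0 < X)%N. Proof. by rewrite truncn_gt0. Qed.
Let X_le : X%:R <= x. Proof. by rewrite truncn_le ltW. Qed.

Lemma trunc_powR_gt0 : (0 < D)%N.
Proof. by rewrite truncn_gt0 powR_ge1 //; case/andP: kappa01. Qed.

Lemma trunc_powR_le : (D <= X)%N.
Proof.
apply: le_truncn; rewrite -[leRHS](powRr1 (ltW x_gt0)) ler_powR //.
by case/andP: kappa01.
Qed.

Lemma log_factors_le :
  (1 + ln D%:R) * (trunc_log q D).+1%:R * M%:R <= 2 * (1 + ln x) ^+ 3.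
Proof.
have D_gt0 := trunc_powR_gt0; set l := 1 + ln x.
have lnx_ge0 : 0 <= ln x by exact: ln_ge0.
have lnD_le : 1 + ln D%:R <= l.
  rewrite lerD2l ler_ln ?posrE ?ltr0n // (le_trans _ X_le) // ler_nat.
  exact: trunc_powR_le.
have log_le : (trunc_log q X).+1%:R <= l.
  have /andP[qlog_le _] := trunc_log_bounds q_gt1 X_gt0.
  rewrite /l -nat1r lerD2l; apply: le_trans (ler_peMr (ler0n _ _) ln_base_ge1) _.
  rewrite mulr_natl -lnXn // ler_ln ?posrE ?exprn_gt0 // (le_trans _ X_le) //.
  by rewrite -natrX ler_nat.
have logD_le : (trunc_log q D).+1%:R <= l.
  by apply: le_trans log_le; rewrite ler_nat ltnS leq_trunc_log // trunc_powR_le.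
have M_le : M%:R <= 2 * l by rewrite -natr1; have : 1 <= l by [rewrite lerDl]; lra.
rewrite (_ : 2 * l ^+ 3 = l * l * (2 * l)); last by ring.
have lnD_ge0 : 0 <= 1 + ln D%:R :> R by rewrite addr_ge0 // ln_ge0 // ler1n.
by apply: ler_pM; rewrite ?mulr_ge0 // ler_pM.
Qed.

Lemma powR_exp_log_le s : 0 <= s -> (q%:R `^ s) ^+ M <= (q%:R `^ s) ^+ 2 * x `^ s.
Proof.
move=> s_ge0; rewrite -add2n exprD ler_wpM2l ?exprn_ge0 ?powR_ge0 //.
apply: le_trans (powR_exp_trunc_log q_gt1 X_gt0 s_ge0) _.
by rewrite ge0_ler_powR ?nnegrE // ltW.
Qed.

Lemma power_factors_le C : 0 <= C ->
  q%:R ^+ 2 * D%:R * A ^+ M + q%:R * C * rho ^+ M <=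
  (q%:R ^+ 2 * A ^+ 2 + q%:R * C * rho ^+ 2) * (x `^ (kappa + theta q) + x `^ mu).
Proof.
move=> C_ge0; rewrite mulrDr mulrDl [X in _ <= _ + X]mulrDl.
have D_le : D%:R <= x `^ kappa by rewrite truncn_le powR_ge0.
rewrite lerD //.
  apply: (@le_trans _ _ (q%:R ^+ 2 * A ^+ 2 * x `^ (kappa + theta q))).
    rewrite powRD_gt0 // -[leLHS]mulrA -[leRHS]mulrA ler_wpM2l ?exprn_ge0 //.
    by rewrite [leRHS]mulrCA ler_pM ?exprn_ge0 ?powR_ge0 // powR_exp_log_le ?theta_ge0.
  by rewrite lerDl !mulr_ge0 ?exprn_ge0 ?powR_ge0.
apply: (@le_trans _ _ (q%:R * C * rho ^+ 2 * x `^ mu)).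
  by rewrite -[leRHS]mulrA ler_wpM2l ?mulr_ge0 // powR_exp_log_le.
by rewrite lerDr !mulr_ge0 ?exprn_ge0 ?powR_ge0.
Qed.

Lemma sum_multiples_bound_le_powR beta C : 0 <= beta ->
  (forall N alpha, digit_product q beta N alpha <= C * rho ^+ N) ->
  total_weight R q ^+ 2 <= q%:R * rho ^+ 2 ->
  \sum_(1 <= d < D.+1) multiples_bound q beta M d <=
  2 * q%:R * (2 * (1 + ln x) ^+ 3 *
    ((q%:R ^+ 2 * A ^+ 2 + q%:R * C * rho ^+ 2) * (x `^ (kappa + theta q) + x `^ mu))).
Proof.
move=> beta_ge0 decay weight_le.
have A_ge1 : 1 <= A by rewrite powR_ge1 ?theta_ge0 // ler1n.
have rho_ge1 : 1 <= rho by rewrite powR_ge1 // ler1n.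
have C_ge0 : 0 <= C.
  by have := decay 0%N 0; rewrite /digit_product big_ord0 mulr1; apply: le_trans.
apply: le_trans (sum_multiples_bound_le q_gt1 beta_ge0 rho_ge1 decay weight_le A_ge1
  total_weight_le_theta M trunc_powR_gt0) _.
rewrite ler_wpM2l ?mulr_ge0 // ler_pM ?log_factors_le ?power_factors_le //.
  by rewrite !mulr_ge0 // addr_ge0 // ln_ge0 // ler1n trunc_powR_gt0.
by apply: addr_ge0; apply: mulr_ge0; rewrite ?exprn_ge0 ?powR_ge0 // mulr_ge0.
Qed.

End LargeX.

Lemma ltn_double_expn_trunc_log X : (0 < X)%N -> (X.*2 < q ^ (trunc_log q X).+2)%N.
Proof.
move=> X_gt0; have /andP[_ lt_X] := trunc_log_bounds q_gt1 X_gt0.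
rewrite -mul2n expnS; apply: leq_ltn_trans (leq_mul q_gt1 (leqnn X)) _.
by rewrite ltn_mul2l q_gt0.
Qed.

Lemma twisted_tau_sum_le_powR k (beta mu C W x : R) : 0 <= beta -> 0 <= mu ->
  (forall N alpha, digit_product q beta N alpha <= C * (q%:R `^ mu) ^+ N) ->
  total_weight R q ^+ 2 <= q%:R * (q%:R `^ mu) ^+ 2 ->
  1 <= x -> 0 <= W -> (forall d, (0 < d)%N -> d%:R <= x -> (tau k d)%:R <= W) ->
  normc (twisted_tau_sum q beta k.+1 (Num.truncn x)) <=
  k.+1%:R * (W * (2 * q%:R * (2 * (1 + ln x) ^+ 3 *
    ((q%:R ^+ 2 * (q%:R `^ theta q) ^+ 2 + q%:R * C * (q%:R `^ mu) ^+ 2) *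
     (x `^ (1 - k.+1%:R^-1 + theta q) + x `^ mu))))).
Proof.
move=> beta_ge0 mu_ge0 decay weight_le x_ge1 W_ge0 tau_le.
have kappa01 : 0 <= (1 - k.+1%:R^-1 : R) <= 1.
  by rewrite subr_ge0 invf_le1 ?ltr0n // ler1n /= gerBl invr_ge0.
have X_gt0 : (0 < Num.truncn x)%N by rewrite truncn_gt0.
have X_le : (Num.truncn x)%:R <= x by rewrite truncn_le (le_trans _ x_ge1).
have D_gt0 := trunc_powR_gt0 x_ge1 kappa01; have le_DX := trunc_powR_le x_ge1 kappa01.
have le_D d : (d ^ k.+1 <= Num.truncn x ^ k)%N ->
    (d <= Num.truncn (x `^ (1 - k.+1%:R^-1)))%N.
  by move=> le_d; rewrite truncn_ge_nat ?powR_ge0 // (nat_le_powR X_le).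
apply: le_trans (normc_twisted_tau_sum_le _ q_gt1 (ltn_double_expn_trunc_log X_gt0)
  D_gt0 le_DX le_D _) _ => [d /andP[d_gt0 le_dD]|].
  by apply: tau_le => //; apply: le_trans X_le; rewrite ler_nat (leq_trans le_dD).
by rewrite !ler_wpM2l // sum_multiples_bound_le_powR.
Qed.

End Exponents.

(** * Conclusion *)

Lemma twisted_tau_sum_bound (R : realType) (p q k : nat) (mu eps : R) :
  (1 < q)%N -> coprime (q - 1) p -> theta q < 2^-1 :> R -> 0 < mu < 1 ->
  q%:R * (q%:R - residue_gap R q p ^+ 2) <= (q%:R `^ mu) ^+ 2 ->
  total_weight R q ^+ 2 <= q%:R * (q%:R `^ mu) ^+ 2 -> 0 < eps ->
  exists2 K, 0 <= K & forall b x, (0 < b < p)%N -> 1 <= x ->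
    normc (twisted_tau_sum q (b%:R / p%:R : R) k.+1 (Num.truncn x)) <=
    K * (x `^ (1 - k.+1%:R^-1 + theta q + eps) + x `^ (mu + eps)).
Proof.
move=> q_gt1 coprime_qp theta_lt /andP[mu_gt0 mu_lt1] mu_decay mu_weight eps_gt0.
pose eta := eps / 4; have eta_gt0 : 0 < eta by rewrite divr_gt0.
have [W W_ge0 tau_le] := tau_le_powR k eta_gt0.
pose rho : R := q%:R `^ mu; pose C := q%:R / rho.
have rho_gt0 : 0 < rho by rewrite powR_gt0 // ltr0n ltnW.
have rho_le : rho <= q%:R by rewrite ler1_powR ?ler1n ?(ltnW q_gt1) // ltW.
have C_ge0 : 0 <= C by rewrite divr_ge0 // ltW.
pose K0 := q%:R ^+ 2 * (q%:R `^ theta q) ^+ 2 + q%:R * C * rho ^+ 2.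
have K0_ge0 : 0 <= K0.
  by apply: addr_ge0; apply: mulr_ge0; rewrite ?exprn_ge0 ?powR_ge0 // mulr_ge0.
pose c := 1 + eta^-1; have c_ge0 : 0 <= c by rewrite addr_ge0 // invr_ge0 ltW.
exists (k.+1%:R * (W * (2 * q%:R * (2 * c ^+ 3 * K0)))) => [|b x b_range x_ge1].
  by rewrite !mulr_ge0 ?exprn_ge0.
have x_gt0 : 0 < x by exact: lt_le_trans x_ge1.
have beta_ge0 : 0 <= b%:R / p%:R :> R by rewrite divr_ge0.
have decay := digit_product_decay q_gt1 (residue_gap_ge0 R q p)
  (residue_gap_le R q_gt1 b_range coprime_qp) rho_gt0 rho_le mu_decay.
pose y := x `^ eta; have y_ge0 : 0 <= y by exact: powR_ge0.
pose S := x `^ (1 - k.+1%:R^-1 + theta q) + x `^ mu.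
have S_ge0 : 0 <= S by rewrite addr_ge0 ?powR_ge0.
have -> : x `^ (1 - k.+1%:R^-1 + theta q + eps) + x `^ (mu + eps) = y ^+ 4 * S.
  rewrite !(powRD_gt0 _ eps) // -mulrDl mulrC -powR_mulrn // -powRrM.
  by rewrite /eta divfK.
have tau_le_y d : (0 < d)%N -> d%:R <= x -> (tau k d)%:R <= W * y.
  move=> d_gt0 le_dx; apply: le_trans (tau_le d d_gt0) _; rewrite ler_wpM2l //.
  by rewrite ge0_ler_powR ?nnegrE ?(ltW eta_gt0) ?(ltW x_gt0).
apply: le_trans (twisted_tau_sum_le_powR q_gt1 theta_lt beta_ge0 (ltW mu_gt0) decay
  mu_weight x_ge1 (mulr_ge0 W_ge0 y_ge0) tau_le_y) _; rewrite -/rho -/K0 -/S.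
have ln_le : (1 + ln x) ^+ 3 <= (c * y) ^+ 3.
  by rewrite lerXn2r ?nnegrE ?addr_ge0 ?mulr_ge0 ?ln_ge0 // ln1D_le_powR.
have -> : k.+1%:R * (W * (2 * q%:R * (2 * c ^+ 3 * K0))) * (y ^+ 4 * S) =
    k.+1%:R * (W * y * (2 * q%:R * (2 * (c * y) ^+ 3 * (K0 * S)))) by ring.
by rewrite !ler_wpM2l ?mulr_ge0 // ler_wpM2r ?mulr_ge0 // ler_wpM2l.
Qed.

Lemma eqz_mod_dvdn (p : nat) (a : int) : (0 < p)%N -> exists a' : nat, forall n : nat,
  (n%:Z == a %[mod p%:Z])%Z = (p %| n + a')%N.
Proof.
move=> p_gt0; have pZ_neq0 : p%:Z != 0 by rewrite -lt0n.
have mod_ge0 := modz_ge0 a pZ_neq0; have mod_lt := ltz_pmod a (p_gt0 : 0 < p%:Z).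
exists `|p%:Z - (a %% p)%Z|%N => n; rewrite eqz_mod_dvd.
have -> : (p %| n + `|p%:Z - (a %% p)%Z|)%N =
    (p%:Z %| n%:Z + (p%:Z - (a %% p)%Z))%Z.
  have <- : `|p%:Z - (a %% p)%Z|%N%:Z = p%:Z - (a %% p)%Z.
    by rewrite gez0_abs // subr_ge0 ltW.
  by rewrite -PoszD dvdzE !absz_nat.
have -> : n%:Z + (p%:Z - (a %% p)%Z) = n%:Z - a + ((a %/ p)%Z + 1) * p%:Z.
  by rewrite {2}(divz_eq a p) mulrDl mul1r; ring.
by rewrite [RHS]rpredDr // dvdz_mull // dvdzz.
Qed.

Lemma sum_tau_digit_expansion (R : realType) (k p q : nat) (a : int) (x : R) : (0 < p)%N ->
  exists a' : nat, p%:R * (sum_tau_digit k p q a x)%:R =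
    \sum_(b < p) expi2pi (b%:R / p%:R : R) ^+ a' *
      twisted_tau_sum q (b%:R / p%:R : R) k (Num.truncn x).
Proof.
move=> p_gt0; have [a' residueE] := eqz_mod_dvdn a p_gt0; exists a'.
rewrite /sum_tau_digit natr_sum mulr_sumr big_mkcond /=.
under [RHS]eq_bigr do rewrite mulr_sumr.
rewrite exchange_big /=; apply: eq_bigr => n _.
transitivity ((\sum_(b < p) expi2pi (b%:R / p%:R : R) ^+ (digit_sum q n + a')) *+ tau k n).
  rewrite sum_expi2pi_rat // residueE; case: ifP => _; last by rewrite mul0rn.
  by rewrite mulr_natr.
by rewrite -sumrMnl; apply: eq_bigr => b _; rewrite exprD mulrnAr mulrC.
Qed.

Lemma twisted_tau_sum0 (R : realType) q k (x : R) :
  twisted_tau_sum q (0 : R) k (Num.truncn x) = (sum_tau k x)%:R.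
Proof.
rewrite /twisted_tau_sum /sum_tau natr_sum; apply: eq_bigr => n _.
by rewrite /digit_char expi2pi0 expr1n.
Qed.

Lemma sum_tau_digit_equidistribution (R : realType) (k p q : nat) (a : int) (x E : R) :
  (0 < p)%N -> 0 <= E ->
  (forall b, (0 < b < p)%N ->
    normc (twisted_tau_sum q (b%:R / p%:R : R) k (Num.truncn x)) <= E) ->
  `|(sum_tau_digit k p q a x)%:R - p%:R^-1 * (sum_tau k x)%:R| <= E.
Proof.
move=> p_gt0 E_ge0 twisted_le; have pR_gt0 : 0 < p%:R :> R by rewrite ltr0n.
have [a' expansion] := sum_tau_digit_expansion k q a x p_gt0.
rewrite -(ler_pM2l pR_gt0) -{1}(gtr0_norm pR_gt0) -normrM mulrBr mulVKf ?gt_eqF //.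
rewrite -normc_real rmorphB rmorphM !rmorph_nat expansion.
case: p p_gt0 twisted_le {pR_gt0 expansion} => // p _ twisted_le.
rewrite big_ord_recl /= mul0r expi2pi0 expr1n mul1r twisted_tau_sum0 addrAC subrr add0r.
apply: le_trans (normc_sum_le (b := E) _) _ => [i _|].
  by rewrite normcM normc_expi2piX mul1r twisted_le //= /bump add1n ltnS ltn_ord.
by rewrite card_ord ler_wpM2r // ler_nat.
Qed.

Theorem theorem1 (R : realType) (p q : nat) (hp : (1 < p)%N) (hq : (2 <= q)%N)
    (hpq : coprime (q - 1)%N p) :
  exists lambda : R, 0 < lambda < 1 /\
    forall (k : nat) (eps : R), (2 <= k)%N -> 0 < eps ->
      theta q < (k%:R)^-1 :> R ->
      exists C1 C2 x0 : R, forall (a : int) (x : R), x0 <= x ->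
        `| (sum_tau_digit k p q a x)%:R - (p%:R)^-1 * (sum_tau k x)%:R |
          <= C1 * (x `^ (1 - (k%:R)^-1 + theta q + eps))
             + C2 * (x `^ (lambda + eps)).
Proof.
have p_gt0 := ltnW hp.
have [theta_ge|theta_lt] := leP 2^-1 (theta q : R).
  exists 2^-1; split=> [|k eps k_ge2 _]; first by apply/andP; split; lra.
  have kV_le : k%:R^-1 <= 2^-1 :> R by rewrite lef_pV2 ?posrE ?ltr0n ?ler_nat // ltnW.
  by move=> theta_lt; have := lt_le_trans theta_lt (le_trans kV_le theta_ge); rewrite ltxx.
have [mu mu01 [mu_decay mu_weight]] := exists_decay_exponent p_gt0 hq theta_lt.
exists mu; split=> // -[|k] // eps _ eps_gt0 _.
have [K K_ge0 twisted_le] :=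
  twisted_tau_sum_bound k hq hpq theta_lt mu01 mu_decay mu_weight eps_gt0.
exists K, K, 1 => a x x_ge1; rewrite -mulrDr.
apply: sum_tau_digit_equidistribution => // [|b b_range]; last exact: twisted_le.
by rewrite mulr_ge0 ?addr_ge0 ?powR_ge0.
Qed.
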